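(* Let $\mu$ be a Borel probability measure on $\mathbb R$ with finite second moment and $\nu$ a Borel probability measure on $\mathbb R$ with finite $(2+\delta)$-th absolute moment for some $\delta>0$. For each $\gamma>0$, let $\pi^\gamma$ be a maximizer of $$\pi\mapsto\iint |y-y'|\,e^{-\gamma|x-x'|}\,\mathrm d\pi(x,y)\,\mathrm d\pi(x',y')$$ over $\pi\in\Pi(\mu,\nu)$. Then $\pi^\gamma\to\pi_{\rm dia}$ weakly as $\gamma\to0^+$, where $\pi_{\rm dia}\in\Pi(\mu,\nu)$ is the diamond transport.
   Context: $\Pi(\mu,\nu)$ is the set of all probability measures on $\mathbb R^2$ with marginals $\mu,\nu$. $Q_\mu(t)=\inf\{x\in\mathbb R:\mu((-\infty,x])\ge t\}$ is the left quantile function. Let $D=\{(x,y)\in[0,1]^2:|y-1/2|+|x-1/2|=1/2\}$. The diamond copula $C_{\rm dia}$ is the cdf of the uniform distribution on $D$ (normalized arc length). The diamond transport $\pi_{\rm dia}\in\Pi(\mu,\nu)$ is the law of $(Q_\mu(U),Q_\nu(V))$ where $(U,V)$ has distribution $C_{\rm dia}$. *)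

(* Defs.v *)
From HB Require Import structures.
From mathcomp Require Import all_boot all_order all_algebra.
From mathcomp Require Import ring lra.
From mathcomp Require Import all_classical all_reals all_analysis.
Set Implicit Arguments.
Unset Strict Implicit.
Unset Printing Implicit Defensive.
Import Order.TTheory GRing.Theory Num.Theory.
Import numFieldNormedType.Exports.
Local Open Scope classical_set_scope.
Local Open Scope ring_scope.

(* Borel probability measures on the line and on the plane.  The Borel
   sigma-algebra of the plane is the product of those of the two factors. *)
Notation probR R := (probability (measurableTypeR R) R).
Notation probR2 R := (probability (measurableTypeR R * measurableTypeR R)%type R).

Section Couplings.
Context {R : realType}.

Definition finite_abs_moment (mu : probR R) (p : R) : Prop :=
  (\int[mu]_x (`|x| `^ p)%:E < +oo)%E.

(* Equality of laws is tested on measurable sets only: measures are total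
   functions on sets, unconstrained outside of the sigma-algebra. *)
Definition couplings (mu nu : probR R) : set (probR2 R) :=
  [set pi | (forall A, measurable A -> pi (fst @^-1` A) = mu A) /\
            (forall B, measurable B -> pi (snd @^-1` B) = nu B)].

Definition objective (gamma : R) (pi : probR2 R) : \bar R :=
  (\int[pi]_w \int[pi]_z
    (`|z.2 - w.2| * expR (- (gamma * `|z.1 - w.1|)))%:E)%E.

Definition is_maximizer (mu nu : probR R) (gamma : R) (pi : probR2 R) : Prop :=
  couplings mu nu pi /\
  forall pi', couplings mu nu pi' ->
    (objective gamma pi' <= objective gamma pi)%E.

Definition weakly_converges {I : Type} (F : set_system I)
    (P : I -> probR2 R) (Q : probR2 R) : Prop :=
  forall f : R * R -> R, continuous f -> [bounded f z | z in [set: R * R]] ->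
    \int[P i]_z f z @[i --> F] --> \int[Q]_z f z.

End Couplings.

Section Quantile.
Context {R : realType}.

(* inf is 0 on the empty set and on sets that are not bounded below, so the
   value is the junk 0 for t <= 0, for t > 1, and for t = 1 when the support of
   mu is unbounded above; these t are negligible for the uniform law on [0, 1]. *)
Definition quantile (mu : probR R) (t : R) : R :=
  inf [set x | (t%:E <= mu [set` `]-oo, x]])%E].

Lemma quantile_le (mu : probR R) (t x : R) : 0 < t < 1 ->
  (quantile mu t <= x) = (t%:E <= mu [set` `]-oo, x]])%E.
Proof.
pose idR : measurableTypeR R -> R := idfun.
pose X : {mfun (measurableTypeR R) >-> R} :=
  HB.pack idR (@isMeasurableFun.Build _ _ _ _ idR (@measurable_id _ _ setT)).
pose F := cdf (X : {RV mu >-> R}).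
have FE r : mu [set` `]-oo, r]] = F r by [].
have Fnd r s : r <= s -> (F r <= F s)%E by exact: (@cdf_nondecreasing _ _ _ mu X).
move=> /andP[t0 t1]; rewrite /quantile.
under eq_set do rewrite FE.
rewrite FE; set E := [set x | _].
have [a ta] : exists a, (t%:E < F a)%E.
  have t1' : (t%:E < 1%:E :> \bar R)%E by rewrite lte_fin.
  have tF : \forall r \near +oo, (t%:E < F r)%E.
    exact: (@cvg_cdfy1 _ _ _ mu X _ (open_ereal_gt' t1')).
  by have [a ta] := filter_ex tF; exists a.
have [b tb] : exists b, (F b < t%:E)%E.
  have t0' : (0%:E < t%:E :> \bar R)%E by rewrite lte_fin.
  have tF : \forall r \near -oo, (F r < t%:E)%E.
    exact: (@cvg_cdfNy0 _ _ _ mu X _ (open_ereal_lt' t0')).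
  by have [b tb] := filter_ex tF; exists b.
have E0 : E !=set0 by exists a; exact: ltW.
have lE : has_lbound E.
  exists b => y /= tFy; rewrite leNgt; apply/negP => /ltW /Fnd Fyb.
  by have := lt_le_trans tb (le_trans tFy Fyb); rewrite ltxx.
apply/idP/idP => [Ex|]; last exact: ge_inf.
apply: le_trans (Fnd _ _ Ex).
apply: (cvge_ge _ (@cdf_right_continuous _ _ _ mu X (inf E))).
near=> y.
have yE : 0 < y - inf E by rewrite subr_gt0.
have [e Ee] := inf_adherent yE (conj E0 lE).
by rewrite addrC subrK => /ltW /Fnd; exact: le_trans.
Unshelve. all: by end_near. Qed.

Lemma measurable_quantile (mu : probR R) :
  measurable_fun [set: measurableTypeR R]
    (quantile mu : measurableTypeR R -> measurableTypeR R).
Proof.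
have -> : [set: measurableTypeR R] =
    `]-oo, 0%R] `|` (`]0%R, 1%R[ `|` ([set 1%R] `|` `]1%R, +oo[)).
  apply/seteqP; split=> // x _ /=; rewrite !in_itv/=.
  have [|x0] := leP x 0; first by left.
  have [?|?|->] := ltgtP x 1; right; [left|right; right|right; left] => //.
have m0 D : D `<=` [set t | quantile mu t = 0] ->
    measurable_fun D (quantile mu : measurableTypeR R -> measurableTypeR R).
  move=> D0; apply: (@eq_measurable_fun _ _ (measurableTypeR R)
    (measurableTypeR R) D (cst (0 : R))) => [t|]; last exact: measurable_cst.
  by rewrite inE => /D0 ->.
apply/measurable_funU => //; first by do 2![apply: measurableU => //].
split.
  apply: m0 => t /=; rewrite in_itv/= => t0.
  apply: inf_out => -[_ [b lb]]; have /lb : [set x | (t%:E <= mu [set` `]-oo, x]])%E] (b - 1).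
    by rewrite /= (@le_trans _ _ 0%:E)// lee_fin.
  by rewrite lerBrDr gerDl ler10.
apply/measurable_funU => //; first exact: measurableU.
split.
  move=> mD; apply: (measurability _ (measurable_realfun.RGenOInfty.measurableE R)) => //.
  move=> _ [_ [x ->] <-].
  rewrite (_ : _ `&` _ = `]0, 1[ `&` `](fine (mu [set` `]-oo, x]])), +oo[).
    exact: measurableI.
  apply/seteqP; split=> t /=; rewrite !in_itv/= !andbT => -[t01].
    rewrite ltNge quantile_le// -ltNge => lt; split=> //.
    by rewrite -lte_fin fineK// fin_num_measure.
  rewrite -lte_fin fineK ?fin_num_measure// => lt; split=> //.
  by rewrite ltNge quantile_le// -ltNge.
apply/measurable_funU => //; split; first exact: measurable_fun_set1.
apply: m0 => t /=; rewrite in_itv/= andbT => t1.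
rewrite /quantile (_ : [set x | _] = set0) ?inf0//.
apply/seteqP; split=> // x /= tx.
have := le_trans tx (probability_le1 mu (measurable_itv _)).
by rewrite lee_fin leNgt t1.
Qed.

Definition quantile_pair (mu nu : probR R)
    (u : measurableTypeR R * measurableTypeR R) :
    measurableTypeR R * measurableTypeR R :=
  (quantile mu u.1, quantile nu u.2).

Lemma measurable_quantile_pair (mu nu : probR R) :
  measurable_fun setT (quantile_pair mu nu).
Proof.
apply: measurable_fun_pair.
  exact: (measurableT_comp (measurable_quantile mu) measurable_fst).
exact: (measurableT_comp (measurable_quantile nu) measurable_snd).
Qed.

HB.instance Definition _ (mu nu : probR R) :=
  isMeasurableFun.Build _ _ _ _ (quantile_pair mu nu)
    (measurable_quantile_pair mu nu).

End Quantile.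

Section Diamond.
Local Ltac split_norms :=
  repeat match goal with |- context [`|?x|] => case: (ger0P x) end.
Context {R : realType}.

Definition diamond : set (R * R) :=
  [set p | `|p.2 - 1 / 2| + `|p.1 - 1 / 2| = 1 / 2].

(* Closed constant-speed curve running once, counterclockwise, around the
   diamond, from the vertex (1, 1/2) at t = 0. *)
Definition diamond_curve (t : measurableTypeR R) :
    measurableTypeR R * measurableTypeR R :=
  (`|1 - 2 * t|, `|1 - `|2 * t - 1 / 2| |).

Lemma measurable_diamond_curve : measurable_fun setT diamond_curve.
Proof.
apply: measurable_fun_pair.
  apply: (@measurable_realfun.continuous_measurable_fun R (fun t => `|1 - 2 * t|)) => t.
  apply: cvg_norm; apply: cvgB; first exact: cvg_cst.
  by apply: cvgM; [exact: cvg_cst|exact: cvg_id].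
apply: (@measurable_realfun.continuous_measurable_fun R (fun t => `|1 - `|2 * t - 1 / 2| |)) => t.
apply: cvg_norm; apply: cvgB; first exact: cvg_cst.
apply: cvg_norm; apply: cvgB; last exact: cvg_cst.
by apply: cvgM; [exact: cvg_cst|exact: cvg_id].
Qed.

HB.instance Definition _ :=
  isMeasurableFun.Build _ _ _ _ diamond_curve measurable_diamond_curve.

Lemma diamond_sub_unit_square (p : R * R) :
  diamond p -> 0 <= p.1 <= 1 /\ 0 <= p.2 <= 1.
Proof.
rewrite /diamond /=; split_norms => *; split; lra.
Qed.

Lemma diamond_curve_image : diamond_curve @` `[0, 1] = diamond.
Proof.
apply/seteqP; split=> [_ [t /= + <-]|[x y] /= D].
  by rewrite /diamond /= in_itv/=; split_norms => *; lra.
have [/= x01 y01] := diamond_sub_unit_square D.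
move: D; rewrite /diamond /= => D.
have [y2|y2] := leP (1 / 2) y.
  exists ((1 - x) / 2); first by rewrite /= in_itv/=; lra.
  rewrite (@ger0_norm _ (y - _)) in D; last lra.
  rewrite /diamond_curve (_ : 1 - 2 * _ = x); last by field.
  rewrite (_ : 2 * _ - _ = - (x - 1 / 2)); last by field.
  by rewrite normrN (_ : 1 - `|_| = y); [rewrite !ger0_norm//; lra|lra].
exists ((1 + x) / 2); first by rewrite /= in_itv/=; lra.
rewrite (@ltr0_norm _ (y - _)) in D; last lra.
rewrite /diamond_curve (_ : 1 - 2 * _ = - x); last by field.
rewrite (_ : 2 * _ - _ = x + 1 / 2); last by field.
rewrite (@ger0_norm _ (x + _)); last lra.
rewrite (_ : 1 - (x + 1 / 2) = - (x - 1 / 2)); last by field.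
by rewrite !normrN (@ger0_norm _ x); [congr pair; lra|lra].
Qed.

Lemma diamond_curve_inj : {in `[0, 1[ &, injective diamond_curve}.
Proof.
move=> s t; rewrite !in_itv/= /diamond_curve => s01 t01 [/eqP].
rewrite eqr_norm2 => /orP[/eqP st _|/eqP st]; first by lra.
have {st} sE : s = 1 - t by lra.
rewrite {}sE in s01 *.
by move: s01 t01; split_norms => *; lra.
Qed.

Lemma diamond_curve_speed (k : nat) (s t : R) :
  k%:R / 4 <= s <= k.+1%:R / 4 -> k%:R / 4 <= t <= k.+1%:R / 4 -> (k < 4)%N ->
  Num.sqrt (((diamond_curve t).1 - (diamond_curve s).1) ^+ 2
          + ((diamond_curve t).2 - (diamond_curve s).2) ^+ 2)
  = Num.sqrt 8 * `|t - s|.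
Proof.
move=> sk tk k4.
have [a [b [e [f [e2 f2 cE]]]]] : exists a b e f : R, [/\ e ^+ 2 = 4, f ^+ 2 = 4 &
    forall r : R, k%:R / 4 <= r <= k.+1%:R / 4 ->
      diamond_curve r = (a + e * r, b + f * r)].
  rewrite /diamond_curve; move: k k4 {sk tk} => [|[|[|[|//]]]] _.
  - exists 1, (1 / 2), (- 2), 2; split=> [||r r01]; [ring|ring|].
    by rewrite (@ger0_norm _ (1 - 2 * _)) ?(@ler0_norm _ (_ - 1 / 2)) ?ger0_norm;
      [congr pair; field|lra|lra|lra].
  - exists 1, (3 / 2), (- 2), (- 2); split=> [||r r01]; [ring|ring|].
    by rewrite (@ger0_norm _ (1 - 2 * _)) ?(@ger0_norm _ (_ - 1 / 2)) ?ger0_norm;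
      [congr pair; field|lra|lra|lra].
  - exists (- 1), (3 / 2), 2, (- 2); split=> [||r r01]; [ring|ring|].
    by rewrite (@ler0_norm _ (1 - 2 * _)) ?(@ger0_norm _ (_ - 1 / 2)) ?ger0_norm;
      [congr pair; field|lra|lra|lra].
  - exists (- 1), (- (3 / 2)), 2, 2; split=> [||r r01]; [ring|ring|].
    by rewrite (@ler0_norm _ (1 - 2 * _)) ?(@ger0_norm _ (_ - 1 / 2)) ?ler0_norm;
      [congr pair; field|lra|lra|lra].
rewrite !cE//= -sqrtr_sqr -sqrtrM//; congr Num.sqrt.
have -> : (a + e * t - (a + e * s)) ^+ 2 + (b + f * t - (b + f * s)) ^+ 2 =
  (e ^+ 2 + f ^+ 2) * (t - s) ^+ 2 by ring.
by rewrite e2 f2; ring.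
Qed.

(* Normalized arc length on the diamond: the curve above has constant speed,
   so it carries the uniform law on [0, 1] to normalized arc length on its
   trace. *)
Definition diamond_law : probR2 R :=
  distribution (uniform_prob (@ltr01 R)) diamond_curve.

Definition diamond_transport (mu nu : probR R) : probR2 R :=
  distribution diamond_law (quantile_pair mu nu).

End Diamond.

(* Main.v *)
Require Import Defs.
From HB Require Import structures.
From mathcomp Require Import all_boot all_order all_algebra.
From mathcomp Require Import ring lra.
From mathcomp Require Import all_classical all_reals all_analysis.
From mathcomp Require Import measurable_realfun.
Import Order.TTheory GRing.Theory Num.Theory.
Import numFieldNormedType.Exports.
Set Implicit Arguments.
Unset Strict Implicit.
Unset Printing Implicit Defensive.
Local Open Scope classical_set_scope.
Local Open Scope ring_scope.

(** Let [r = |x - x'|] and [d = |y - y'|] for two independent points [(x, y)] and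
    [(x', y')] with law [pi].  Since [exp (- gamma * r)] is [1 - gamma * r] to first
    order and the mean of [d] depends on [nu] only, maximizing the objective for
    small [gamma] amounts to minimizing the interaction [K pi], the mean of [r * d].

    The interaction has the diamond transport as unique minimizer.  By the layer-cake
    formula, [r * d] is the measure of the set of vertices [(s, t)] that separate the
    two points in both coordinates; hence [K pi] is the integral over [(s, t)] of the
    probability of this event, a quadratic polynomial in the value [h] at [(s, t)] of
    the joint distribution function of [pi], whose other coefficients depend on the
    marginals ([interaction_discordance]).  Its vertex is [(a + b) / 2 - 1 / 4], with
    [a] and [b] the marginal distribution functions, and projecting it on the Frechet
    bounds gives [diamond_copula a b] ([diamond_copula_minimizes]), which is the value
    of the joint distribution function of the diamond transport
    ([cdf2_diamond_transport]).  Pointwise minimization is therefore achieved, and by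
    strong convexity [K pi] exceeds the minimum by at least four times the squared
    L2 distance between the joint distribution functions ([interaction_gap]).

    The error in the first-order expansion is uniform over couplings
    ([integral_weighted_error]): Young's inequality splits it into functions of one
    coordinate, and the second moments allow dominated convergence.  So the joint
    distribution functions of the maximizers converge in L2 to that of the diamond
    transport ([cdf2_gap_cvg]).  The increments of a joint distribution function being
    controlled by those of its marginals, which are fixed and right-continuous, the
    convergence holds at every point ([cdf2_cvg_of_gap]); with fixed marginals,
    pointwise convergence implies weak convergence by approximation with step
    functions on a grid ([weak_cvg_of_cdf2]). *)

(** * Quadrants and the layer-cake formula *)

Section Basics.
Context {R : realType}.
Local Notation line := (measurableTypeR R).
Local Notation plane := (measurableTypeR R * measurableTypeR R)%type.
Implicit Types (mu nu : probR R) (pi : probR2 R).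

Lemma measurable_coord11 : measurable_fun setT (fun p : plane * plane => p.1.1).
Proof. exact: (measurableT_comp measurable_fst measurable_fst). Qed.

Lemma measurable_coord12 : measurable_fun setT (fun p : plane * plane => p.1.2).
Proof. exact: (measurableT_comp measurable_snd measurable_fst). Qed.

Lemma measurable_coord21 : measurable_fun setT (fun p : plane * plane => p.2.1).
Proof. exact: (measurableT_comp measurable_fst measurable_snd). Qed.

Lemma measurable_coord22 : measurable_fun setT (fun p : plane * plane => p.2.2).
Proof. exact: (measurableT_comp measurable_snd measurable_snd). Qed.

Definition cdf1 mu (s : R) : R := fine (mu [set` `]-oo, s]]).

Definition quadrant (s t : R) : set plane := [set z | z.1 <= s /\ z.2 <= t].

Definition cdf2 pi (s t : R) : R := fine (pi (quadrant s t)).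

(** Real-valued, so that probabilities of quadrants become integrals of
    polynomials in these indicators. *)
Definition below (s x : R) : R := (x <= s)%R%:R.

Definition separation (s x x' : R) : R := (below s x - below s x') ^+ 2.

Lemma measurable_below d (T : measurableType d) (f g : T -> R) :
  measurable_fun setT f -> measurable_fun setT g ->
  measurable_fun setT (fun p => below (g p) (f p)).
Proof.
move=> mf mg; rewrite /below.
apply: (eq_measurable_fun (fun p => if f p <= g p then 1 : R else 0)).
  by move=> x _; case: ifP.
by apply: measurable_fun_ifT => //; exact: measurable_fun_ler.
Qed.

Lemma measurable_separation d (T : measurableType d) (f g h : T -> R) :
  measurable_fun setT f -> measurable_fun setT g -> measurable_fun setT h ->
  measurable_fun setT (fun p => separation (h p) (f p) (g p)).
Proof.
move=> mf mg mh; apply: measurable_funX.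
by apply: measurable_funB; apply: measurable_below.
Qed.

Lemma separation_ge0 s x x' : 0 <= separation s x x'.
Proof. exact: sqr_ge0. Qed.

Lemma measurable_quadrant s t : measurable (quadrant s t).
Proof.
rewrite (_ : quadrant s t = `]-oo, s] `*` `]-oo, t]); first exact: measurableX.
by apply/seteqP; split=> z; rewrite /quadrant /= !in_itv.
Qed.

Lemma below_quadrant s t (z : plane) :
  below s z.1 * below t z.2 = \1_(quadrant s t) z.
Proof.
rewrite /below indicE -natrM mulnb; congr ((nat_of_bool _)%:R).
by apply/idP/idP => [/andP[? ?]|]; rewrite ?inE //= => -[-> ->].
Qed.

(** Layer-cake formula: as a function of [s], the separation is the indicator of the
    half-open interval between the two points.  It turns a product of distances
    into an integral of probabilities of quadrants. *)
Lemma integral_separation (x x' : R) :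
  (\int[@lebesgue_measure R]_s (separation s x x')%:E = `|x - x'|%:E)%E.
Proof.
wlog xx' : x x' / x <= x'.
  move=> W; have [|/ltW x'x] := leP x x'; first exact: W.
  rewrite distrC -W//; apply: eq_integral => s _.
  by rewrite /separation; congr (_%:E); ring.
transitivity (\int[@lebesgue_measure R]_s (\1_(`[x, x'[%classic : set R) s)%:E)%E.
  apply: eq_integral => s _; congr (_%:E).
  rewrite /separation /below indicE mem_setE in_itv/= ltNge.
  by have [xs|xs] := leP x s; have [x's|x's] := leP x' s; rewrite /=; try ring; lra.
rewrite integral_indic//= setIT lebesgue_measure_itv/= lte_fin.
rewrite ler0_norm ?subr_le0// opprB.
by have [//|] := ltP x x'; case: ltgtP xx' => // -> _ _; rewrite subrr.
Qed.

Lemma cdf1E mu s : mu [set` `]-oo, s]] = (cdf1 mu s)%:E.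
Proof. by rewrite /cdf1 fineK// fin_num_measure. Qed.

Lemma cdf2E pi s t : pi (quadrant s t) = (cdf2 pi s t)%:E.
Proof. by rewrite /cdf2 fineK// fin_num_measure//; exact: measurable_quadrant. Qed.

Lemma coupling_fst mu nu pi s : couplings mu nu pi ->
  pi [set z | z.1 <= s] = (cdf1 mu s)%:E.
Proof.
by move=> [p1 _]; rewrite -cdf1E -p1.
Qed.

Lemma coupling_snd mu nu pi t : couplings mu nu pi ->
  pi [set z | z.2 <= t] = (cdf1 nu t)%:E.
Proof.
by move=> [_ p2]; rewrite -cdf1E -p2.
Qed.

Lemma measurable_fst_le s : measurable [set z : plane | z.1 <= s].
Proof.
rewrite (_ : [set z : plane | _] = `]-oo, s] `*` setT); first exact: measurableX.
by apply/seteqP; split=> z; rewrite /= in_itv//= => -[].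
Qed.

Lemma measurable_snd_le t : measurable [set z : plane | z.2 <= t].
Proof.
rewrite (_ : [set z : plane | _] = setT `*` `]-oo, t]); first exact: measurableX.
by apply/seteqP; split=> z; rewrite /= in_itv//= => -[].
Qed.

(** The four coefficients cover every function of the position of [z] relative to
    the vertex [(s, t)], so that all identities and inequalities between cell
    probabilities follow from pointwise ones. *)
Lemma integral_below_bilinear mu nu pi (s t c0 c1 c2 c3 : R) :
  couplings mu nu pi ->
  (\int[pi]_z (c0 + c1 * below s z.1 + c2 * below t z.2
     + c3 * (below s z.1 * below t z.2))%:E =
   (c0 + c1 * cdf1 mu s + c2 * cdf1 nu t + c3 * cdf2 pi s t)%:E)%E.
Proof.
move=> cpl.
have m1 := measurable_fst_le s; have m2 := measurable_snd_le t.
have m3 := measurable_quadrant s t.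
have iZ c A : measurable A ->
    pi.-integrable setT (fun z => (c * \1_A z)%:E).
  move=> mA; under eq_fun do rewrite EFinM.
  by apply: integrableZl => //; exact: integrable_indic.
have IZ c A : measurable A ->
    (\int[pi]_z (c * \1_A z)%:E = c%:E * pi A)%E.
  move=> mA; under eq_integral do rewrite EFinM.
  by rewrite integralZl ?integral_indic ?setIT//; exact: integrable_indic.
have ic : pi.-integrable setT (fun z : plane => c0%:E).
  exact: finite_measure_integrable_cst.
under eq_integral => z _.
  rewrite below_quadrant (_ : below s z.1 = \1_[set z : plane | z.1 <= s] z);
    last by rewrite indicE mem_setE.
  rewrite (_ : below t z.2 = \1_[set z : plane | z.2 <= t] z);
    last by rewrite indicE mem_setE.
  over.
under eq_integral do rewrite !EFinD.
have i1 := integrableD measurableT ic (iZ c1 _ m1).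
have i2 := integrableD measurableT i1 (iZ c2 _ m2).
rewrite (integralD measurableT i2 (iZ c3 _ m3)).
rewrite (integralD measurableT i1 (iZ c2 _ m2)).
rewrite (integralD measurableT ic (iZ c1 _ m1)).
rewrite !IZ// integral_cst//. rewrite [X in (_ * X + _ + _ + _)%E]probability_setT mule1.
by rewrite (coupling_fst _ cpl) (coupling_snd _ cpl) cdf2E.
Qed.

(** The probability that a vertex separates two independent points of the plane in
    both coordinates, [a] and [b] being the values of the marginal and [h] of the
    joint distribution functions there: an expanded form of
    [2 * (h * (1 - a - b + h) + (a - h) * (b - h))]. *)
Definition discordance (a b h : R) : R :=
  2 * (2 * h ^+ 2 + h * (1 - 2 * a - 2 * b) + a * b).

Lemma integral_separation_pair mu nu pi (s t : R) : couplings mu nu pi ->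
  (\int[pi \x pi]_p
     (separation s p.1.1 p.2.1 * separation t p.1.2 p.2.2)%:E =
   (discordance (cdf1 mu s) (cdf1 nu t) (cdf2 pi s t))%:E)%E.
Proof.
move=> cpl.
rewrite (fubini_tonelli1 (m1 := pi) (m2 := pi)); last 2 first.
- apply/measurable_EFinP/measurable_funM; apply: measurable_separation => //.
  + exact: measurable_coord11.
  + exact: measurable_coord21.
  + exact: measurable_coord12.
  + exact: measurable_coord22.
- by move=> p; rewrite lee_fin mulr_ge0// separation_ge0.
have bb r x : below r x ^+ 2 = below r x.
  by rewrite /below; case: (x <= r); rewrite ?expr1n ?expr0n.
set a := cdf1 mu s; set b := cdf1 nu t; set h := cdf2 pi s t.
under eq_integral => w _.
  rewrite /fubini_F /=.
  have -> : (\int[pi]_z (separation s w.1 z.1 * separation t w.2 z.2)%:E =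
      (b * below s w.1 + a * below t w.2 - 2 * h * below s w.1
       - 2 * h * below t w.2 + h
       + (1 - 2 * a - 2 * b + 4 * h) * (below s w.1 * below t w.2))%:E)%E.
    set I := below s w.1; set J := below t w.2.
    transitivity (\int[pi]_z (I * J + J * (1 - 2 * I) * below s z.1
       + I * (1 - 2 * J) * below t z.2
       + (1 - 2 * I) * (1 - 2 * J) * (below s z.1 * below t z.2))%:E)%E.
      apply: eq_integral => z _; congr (_%:E); rewrite /separation -/I -/J.
      rewrite !sqrrB !bb; ring.
    by rewrite (integral_below_bilinear _ _ _ _ _ _ cpl) -/a -/b -/h; congr (_%:E); ring.
  rewrite (_ : _ + _ = h + (b - 2 * h) * below s w.1 + (a - 2 * h) * below t w.2
    + (1 - 2 * a - 2 * b + 4 * h) * (below s w.1 * below t w.2)); last ring.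
  over.
rewrite (integral_below_bilinear _ _ _ _ _ _ cpl) -/a -/b -/h.
by congr (_%:E); rewrite /discordance; ring.
Qed.

End Basics.

(** * The interaction energy and its minimizer *)

Section Interaction.
Context {R : realType}.
Local Notation line := (measurableTypeR R).
Local Notation plane := (measurableTypeR R * measurableTypeR R)%type.
Local Notation leb := (@lebesgue_measure R).
Implicit Types (mu nu : probR R) (pi : probR2 R).

(** Each bound says that one of the four cells cut out by the vertex has nonnegative
    probability. *)
Lemma frechet_bounds mu nu pi s t : couplings mu nu pi ->
  [/\ 0 <= cdf2 pi s t, cdf1 mu s + cdf1 nu t - 1 <= cdf2 pi s t,
      cdf2 pi s t <= cdf1 mu s & cdf2 pi s t <= cdf1 nu t].
Proof.
move=> cpl.
have pos c0 c1 c2 c3 : (forall z : plane, 0 <= c0 + c1 * below s z.1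
    + c2 * below t z.2 + c3 * (below s z.1 * below t z.2)) ->
    0 <= c0 + c1 * cdf1 mu s + c2 * cdf1 nu t + c3 * cdf2 pi s t.
  move=> nneg; rewrite -lee_fin -(integral_below_bilinear _ _ _ _ _ _ cpl).
  by apply: integral_ge0 => z _; rewrite lee_fin.
split.
- rewrite (_ : cdf2 pi s t = 0 + 0 * cdf1 mu s + 0 * cdf1 nu t + 1 * cdf2 pi s t);
    last ring.
  by apply: pos => z; rewrite /below; case: (z.1 <= s); case: (z.2 <= t); rewrite /=; lra.
- rewrite -subr_ge0 (_ : _ - _ = 1 + (-1) * cdf1 mu s + (-1) * cdf1 nu t + 1 * cdf2 pi s t);
    last ring.
  by apply: pos => z; rewrite /below; case: (z.1 <= s); case: (z.2 <= t); rewrite /=; lra.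
- rewrite -subr_ge0 (_ : _ - _ = 0 + 1 * cdf1 mu s + 0 * cdf1 nu t + (-1) * cdf2 pi s t);
    last ring.
  by apply: pos => z; rewrite /below; case: (z.1 <= s); case: (z.2 <= t); rewrite /=; lra.
- rewrite -subr_ge0 (_ : _ - _ = 0 + 0 * cdf1 mu s + 1 * cdf1 nu t + (-1) * cdf2 pi s t);
    last ring.
  by apply: pos => z; rewrite /below; case: (z.1 <= s); case: (z.2 <= t); rewrite /=; lra.
Qed.

Lemma cdf1_nondecreasing mu : nondecreasing_fun (cdf1 mu).
Proof.
move=> r s rs; rewrite -lee_fin -!cdf1E le_measure ?inE//.
by move=> x /=; rewrite !in_itv/= => /le_trans; apply.
Qed.

Lemma measurable_cdf1 mu : measurable_fun [set: line] (cdf1 mu : line -> line).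
Proof. by apply: nondecreasing_measurable => //; exact: cdf1_nondecreasing. Qed.

(** Joint measurability is that of a partial integral in Tonelli's theorem. *)
Lemma measurable_cdf2 pi : measurable_fun setT (fun p : plane => cdf2 pi p.1 p.2).
Proof.
apply: measurableT_comp => //.
have mf : measurable_fun setT (fun q : plane * plane =>
    (below q.2.1 q.1.1 * below q.2.2 q.1.2)%:E).
  apply/measurable_EFinP/measurable_funM; apply: measurable_below.
  - exact: measurable_coord11.
  - exact: measurable_coord21.
  - exact: measurable_coord12.
  - exact: measurable_coord22.
have := measurable_fun_fubini_tonelli_G (m1 := pi) _ mf.
rewrite (_ : fubini_G _ _ = fun p : plane => pi (quadrant p.1 p.2)).
  by apply=> q; rewrite lee_fin mulr_ge0 /below.
apply/funext => p; rewrite /fubini_G/=.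
under eq_integral do rewrite below_quadrant.
by rewrite integral_indic ?setIT//; exact: measurable_quadrant.
Qed.

Lemma measurable_discordance mu nu pi : measurable_fun setT
  (fun p : plane => discordance (cdf1 mu p.1) (cdf1 nu p.2) (cdf2 pi p.1 p.2)).
Proof.
have m1 : measurable_fun setT (fun p : plane => cdf1 mu p.1).
  exact: (measurableT_comp (measurable_cdf1 mu) measurable_fst).
have m2 : measurable_fun setT (fun p : plane => cdf1 nu p.2).
  exact: (measurableT_comp (measurable_cdf1 nu) measurable_snd).
have m3 := measurable_cdf2 pi.
apply: measurable_funM => //; apply: measurable_funD; last exact: measurable_funM.
apply: measurable_funD.
  by apply: measurable_funM => //; exact: measurable_funX.
apply: measurable_funM => //; apply: measurable_funB; last exact: measurable_funM.
by apply: measurable_funB => //; exact: measurable_funM.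
Qed.

Lemma discordance_ge0 mu nu pi s t : couplings mu nu pi ->
  0 <= discordance (cdf1 mu s) (cdf1 nu t) (cdf2 pi s t).
Proof.
move=> /(@frechet_bounds _ _ _ s t); rewrite /discordance.
move: (cdf1 mu s) (cdf1 nu t) (cdf2 pi s t) => a b h [h0 hab ha hb].
rewrite (_ : 2 * _ = 2 * (h * (1 - a - b + h) + (a - h) * (b - h))); last by ring.
by rewrite mulr_ge0// addr_ge0// mulr_ge0//; lra.
Qed.

Definition interaction_kernel (p : plane * plane) : R :=
  `|p.1.1 - p.2.1| * `|p.1.2 - p.2.2|.

Definition interaction pi : \bar R :=
  (\int[pi \x pi]_p (interaction_kernel p)%:E)%E.

(** Tonelli's theorem and the layer-cake formula in each coordinate: the energy is
    an integral over the vertices [(s, t)] of a function of the value of the joint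
    distribution function there, so it can be minimized pointwise. *)
Lemma interaction_discordance mu nu pi : couplings mu nu pi ->
  interaction pi =
  (\int[leb \x leb]_p
    (discordance (cdf1 mu p.1) (cdf1 nu p.2) (cdf2 pi p.1 p.2))%:E)%E.
Proof.
move=> cpl.
pose PP : probability (plane * plane)%type R := (pi \x pi)%E.
have my : measurable_fun setT (fun p : plane * plane => `|p.1.2 - p.2.2|).
  apply: measurableT_comp => //; apply: measurable_funB.
    exact: measurable_coord12.
  exact: measurable_coord22.
transitivity (\int[PP]_p \int[leb]_s (separation s p.1.1 p.2.1 * `|p.1.2 - p.2.2|)%:E)%E.
  apply: eq_integral => p _; rewrite /interaction_kernel EFinM -integral_separation.
  under [RHS]eq_integral do rewrite EFinM.
  rewrite ge0_integralZr//.
  - apply/measurable_EFinP.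
    by apply: measurable_separation => //; exact: measurable_cst.
  - by move=> s _; rewrite lee_fin separation_ge0.
rewrite (fubini_tonelli (m1 := PP) (m2 := leb) (fun q : (plane * plane) * line =>
  (separation q.2 q.1.1.1 q.1.2.1 * `|q.1.1.2 - q.1.2.2|)%:E)); last 2 first.
- apply/measurable_EFinP/measurable_funM.
    apply: measurable_separation => //.
      exact: (measurableT_comp measurable_coord11 measurable_fst).
    exact: (measurableT_comp measurable_coord21 measurable_fst).
  exact: (measurableT_comp my measurable_fst).
- by move=> q; rewrite lee_fin mulr_ge0// separation_ge0.
rewrite (fubini_tonelli1 (m1 := leb) (m2 := leb)); last 2 first.
- by apply/measurable_EFinP; exact: measurable_discordance.
- by move=> p; rewrite lee_fin; exact: discordance_ge0.
apply: eq_integral => s _; rewrite /fubini_F/=.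
transitivity (\int[PP]_p \int[leb]_t
    (separation s p.1.1 p.2.1 * separation t p.1.2 p.2.2)%:E)%E.
  apply: eq_integral => p _; rewrite EFinM -integral_separation.
  under [RHS]eq_integral do rewrite EFinM.
  rewrite ge0_integralZl//.
  - apply/measurable_EFinP.
    by apply: measurable_separation => //; exact: measurable_cst.
  - by move=> t _; rewrite lee_fin separation_ge0.
  - by rewrite lee_fin separation_ge0.
rewrite (fubini_tonelli (m1 := PP) (m2 := leb) (fun q : (plane * plane) * line =>
  (separation s q.1.1.1 q.1.2.1 * separation q.2 q.1.1.2 q.1.2.2)%:E)); last 2 first.
- apply/measurable_EFinP/measurable_funM.
    apply: measurable_separation => //.
      exact: (measurableT_comp measurable_coord11 measurable_fst).
    exact: (measurableT_comp measurable_coord21 measurable_fst).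
  apply: measurable_separation => //.
    exact: (measurableT_comp measurable_coord12 measurable_fst).
  exact: (measurableT_comp measurable_coord22 measurable_fst).
- by move=> q; rewrite lee_fin mulr_ge0// separation_ge0.
by apply: eq_integral => t _ /=; exact: integral_separation_pair.
Qed.

(** The vertex [(a + b) / 2 - 1 / 4] of the parabola [discordance a b], clipped to the
    Frechet bounds; it is the distribution function of the uniform law on the
    diamond. *)
Definition diamond_copula (a b : R) : R :=
  Num.max (Num.max 0 (a + b - 1)) (Num.min (Num.min a b) ((a + b) / 2 - 1 / 4)).

(** Clipping projects the vertex [c] of a parabola of leading coefficient [4] onto an
    interval; the projection [d] satisfies [(h - d) * (d - c) >= 0] for [h] in the
    interval, which gives quadratic growth away from the minimizer. *)
Lemma diamond_copula_minimizes (a b h : R) :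
  0 <= h -> a + b - 1 <= h -> h <= a -> h <= b ->
  discordance a b (diamond_copula a b) + 4 * (h - diamond_copula a b) ^+ 2
    <= discordance a b h.
Proof.
move=> h0 hab ha hb; set d := diamond_copula a b; set c := (a + b) / 2 - 1 / 4.
have dc : 0 <= (h - d) * (d - c).
  have Lh : Num.max 0 (a + b - 1) <= h by rewrite ge_max h0.
  have hU : h <= Num.min a b by rewrite le_min ha.
  rewrite /d /diamond_copula -/c.
  move: (Num.max 0 _) (Num.min a b) Lh hU => L U Lh hU.
  have [cU|Uc] := leP c U; first last.
    by rewrite max_r ?(le_trans Lh)// mulr_le0// subr_le0// ltW.
  have [Lc|cL] := leP L c; first by rewrite subrr mulr0.
  by rewrite mulr_ge0// subr_ge0// ltW.
rewrite -subr_ge0 (_ : _ - _ = 8 * ((h - d) * (d - c))); last first.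
  by rewrite /discordance /c; field.
by rewrite mulr_ge0.
Qed.

(** Quantitative uniqueness of the minimizer: an almost minimal energy forces the
    joint distribution functions to be close in the mean square. *)
Lemma interaction_gap mu nu pi pi0 : couplings mu nu pi -> couplings mu nu pi0 ->
  (forall s t, cdf2 pi0 s t = diamond_copula (cdf1 mu s) (cdf1 nu t)) ->
  (interaction pi0 + 4%:E * \int[leb \x leb]_p
     ((cdf2 pi p.1 p.2 - cdf2 pi0 p.1 p.2) ^+ 2)%:E <= interaction pi)%E.
Proof.
move=> cpl cpl0 dia.
have mD : measurable_fun setT (fun p : plane => (cdf2 pi p.1 p.2 - cdf2 pi0 p.1 p.2) ^+ 2).
  by apply: measurable_funX; apply: measurable_funB; exact: measurable_cdf2.
rewrite (interaction_discordance cpl0) (interaction_discordance cpl).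
rewrite -ge0_integralZl//; last 2 first.
- exact/measurable_EFinP.
- by move=> p _; rewrite lee_fin sqr_ge0.
rewrite -ge0_integralD//; first last.
- by apply/measurable_EFinP/measurable_funM.
- by move=> p _; rewrite lee_fin mulr_ge0// sqr_ge0.
- by apply/measurable_EFinP; exact: measurable_discordance.
- by move=> p _; rewrite lee_fin; exact: discordance_ge0.
apply: ge0_le_integral => //.
- by move=> p _; rewrite lee_fin addr_ge0 ?discordance_ge0// mulr_ge0// sqr_ge0.
- apply/measurable_EFinP/measurable_funD; first exact: measurable_discordance.
  exact: measurable_funM.
- by apply/measurable_EFinP; exact: measurable_discordance.
move=> p _; rewrite lee_fin dia.
by have [] := frechet_bounds p.1 p.2 cpl; exact: diamond_copula_minimizes.
Qed.

End Interaction.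

(** * The diamond transport *)

Section DiamondTransport.
Context {R : realType}.
Local Notation line := (measurableTypeR R).
Local Notation plane := (measurableTypeR R * measurableTypeR R)%type.
Local Notation leb := (@lebesgue_measure R).
Implicit Types (mu nu : probR R) (pi : probR2 R).

Lemma probability_eq_of_cdf (P Q : probR R) :
  (forall s, P [set` `]-oo, s]] = Q [set` `]-oo, s]]) ->
  forall A, measurable A -> P A = Q A.
Proof.
(* The right half-lines form a generating pi-system that covers the line. *)
move=> PQ; have tail x : P `]x, +oo[%classic = Q `]x, +oo[%classic.
  by rewrite -setCitvl !probability_setC// PQ.
move=> A mA; refine (@measure_unique _ R line (@RGenOInfty.G R)
  (fun n => `](- n%:R)%R, +oo[%classic) _ _ _ _ P Q _ _ A mA).
- exact: RGenOInfty.measurableE.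
- move=> _ _ [x ->] [y ->]; exists (Num.max x y).
  by apply/seteqP; split=> z /=; rewrite !in_itv/= !andbT gt_max;
    [move=> [-> ->]|move=> /andP[]].
- by move=> n; exists (- n%:R).
- apply/seteqP; split=> // x _; exists (Num.truncn (- x)).+1 => //=.
  by rewrite in_itv/= andbT ltrNl truncnS_gt.
- by move=> _ [x ->]; exact: tail.
- by move=> n; rewrite (le_lt_trans (probability_le1 _ _)) ?ltry.
Qed.

Lemma uniform01E (A : set line) : measurable A ->
  uniform_prob (@ltr01 R) A = leb (A `&` `[0, 1]).
Proof.
move=> mA; rewrite /uniform_prob integral_uniform_pdf.
rewrite (eq_integral (cst 1%E)); last first.
  by move=> x; rewrite inE/= in_itv/= /uniform_pdf => -[_ ->]; rewrite subr0 invr1.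
by rewrite integral_cst ?mul1e//; exact: measurableI.
Qed.


(** The times at which the diamond curve is in the quadrant below [(a, b)] form an
    interval in the last three quarters of the period and one in the first quarter,
    the latter nonempty when [a + b] exceeds [3/2]; the summands are their lengths. *)
Lemma diamond_arc_lengths (a b : R) : 0 <= a <= 1 -> 0 <= b <= 1 ->
  Num.max 0 (Num.min ((1 + a) / 2) (3 / 4 + b / 2)
             - Num.max ((1 - a) / 2) (3 / 4 - b / 2))
  + Num.max 0 (b / 2 - 1 / 4 - (1 - a) / 2) = diamond_copula a b.
Proof.
move=> /andP[a0 a1] /andP[b0 b1]; rewrite /diamond_copula.
have [ab|ab] := ltP (1 / 2) (a - b).
  rewrite (@min_r _ _ ((1 + a) / 2)); last lra.
  rewrite (@max_r _ _ ((1 - a) / 2)); last lra.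
  rewrite (@min_r _ _ a); last lra.
  rewrite (@min_l _ _ b); last lra.
  rewrite (@max_l _ _ 0 (b / 2 - _ - _)); last lra.
  by rewrite (@max_r _ _ 0 (_ - (_ - _))) ?(@max_r _ _ (Num.max _ _)) ?ge_max; lra.
have [ba|ba] := ltP (1 / 2) (b - a).
  rewrite (@min_l _ _ ((1 + a) / 2)); last lra.
  rewrite (@max_l _ _ ((1 - a) / 2)); last lra.
  rewrite (@min_l _ _ a b); last lra.
  rewrite (@min_l _ _ a); last lra.
  rewrite (@max_l _ _ 0 (b / 2 - _ - _)); last lra.
  by rewrite (@max_r _ _ 0 (_ - (_ - _) / 2)) ?(@max_r _ _ (Num.max _ _)) ?ge_max; lra.
rewrite (@min_l _ _ ((1 + a) / 2)); last lra.
rewrite (@max_r _ _ ((1 - a) / 2)); last lra.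
rewrite (@min_r _ _ (Num.min a b)); last by rewrite le_min; lra.
have [s1|s1] := leP (a + b) (1 / 2).
  by rewrite !max_l ?ge_max ?le_max; lra.
have [s2|s2] := leP (3 / 2) (a + b).
  rewrite (@max_r _ _ 0 (a + b - 1)); last lra.
  rewrite (@max_l _ _ (a + b - 1)); last lra.
  by rewrite !max_r; lra.
rewrite (@max_l _ _ 0 (b / 2 - _ - _)); last lra.
by rewrite (@max_r _ _ 0) ?(@max_r _ _ (Num.max _ _)) ?ge_max; lra.
Qed.

(** Quantile functions are only controlled on the open unit interval, whence the
    predicates [P] and [Q], which stand for the events that a quantile is at most a
    given number; the boundary of the square is met at finitely many times.
    Taking one of the predicates constantly true gives the marginals. *)
Lemma diamond_curve_quadrant (P Q : R -> Prop) (a b : R) :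
  0 <= a <= 1 -> 0 <= b <= 1 ->
  (forall u, 0 < u < 1 -> P u <-> u <= a) ->
  (forall v, 0 < v < 1 -> Q v <-> v <= b) ->
  measurable [set t : line | P (diamond_curve t).1 /\ Q (diamond_curve t).2] ->
  leb ([set t | P (diamond_curve t).1 /\ Q (diamond_curve t).2] `&` `[0, 1]) =
  (diamond_copula a b)%:E.
Proof.
move=> a01 b01 Pa Qb mA; set A := [set t | _] in mA *.
(* The times at which the curve is on the boundary of the square, and the right
   end of [J2], left out of [J2] to keep it disjoint from [J1]. *)
pose N : set R := [set` [:: 0; 1 / 4; 1 / 2; 3 / 4; 1; b / 2 - 1 / 4]].
have cN : countable N by apply: finite_set_countable; exact: finite_seq.
have N0 : leb N = 0.
  exact: countable_lebesgue_measure0.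
have mN : measurable (N : set line).
  exact: countable_measurable.
pose J1 : set R := `[Num.max ((1 - a) / 2) (3 / 4 - b / 2),
                     Num.min ((1 + a) / 2) (3 / 4 + b / 2)]%classic.
pose J2 : set R := `[(1 - a) / 2, b / 2 - 1 / 4[%classic.
have mJ1 : measurable (J1 : set line) by exact: measurable_itv.
have mJ2 : measurable (J2 : set line) by exact: measurable_itv.
have J12 : [disjoint J1 & J2].
  apply/disj_setPS => t []; rewrite /J1 /J2 /= !in_itv/= ge_max le_min.
  by move=> /andP[/andP[_ h1] _] /andP[_ h2]; lra.
have mA01 : measurable (A `&` `[0, 1] : set line) by exact: measurableI.
rewrite -(measureU0 (mu := leb) mA01 mN N0).
have -> : (A `&` `[0, 1]) `|` N = (J1 `|` J2) `|` N.
  have key t : 0 <= t <= 1 -> ~ N t -> A t <-> (J1 `|` J2) t.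
    move=> t01 nN.
    have {nN} [] : [/\ t != 0, t != 1 / 4, t != 1 / 2 & t != 3 / 4] /\
        t != 1 /\ t != b / 2 - 1 / 4.
      by split; [split|split]; apply/eqP => tE; apply: nN; rewrite /N /= !inE tE eqxx ?orbT.
    move=> [/eqP n0 /eqP n1 /eqP n2 /eqP n3] [/eqP n4 /eqP n5].
    rewrite /A /J1 /J2 /= /diamond_curve/=.
    rewrite Pa; last by case: (ger0P (1 - 2 * t)) => ?; lra.
    rewrite Qb; last by case: (ger0P (2 * t - 1 / 2)) => ?; case: ger0P => ?; lra.
    rewrite !in_itv/= ge_max le_min.
    by case: (ger0P (1 - 2 * t)) => ?; case: (ger0P (2 * t - 1 / 2)) => ?;
      case: ger0P => ?; lra.
  apply/seteqP; split=> t [|]; try by right.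
    move=> [At /=]; rewrite in_itv/= => t01.
    by have [Nt|nN] := pselect (N t); [right|left; apply/(key _ t01 nN)].
  move=> Jt; have [Nt|nN] := pselect (N t); [by right|left].
  have t01 : 0 <= t <= 1.
    by case: Jt; rewrite /J1 /J2 /= in_itv/= ?ge_max ?le_min => ?; lra.
  by split; [apply/(key _ t01 nN)|rewrite /= in_itv].
rewrite measureU0//; last exact: measurableU.
rewrite measureU//; last by apply/eqP; rewrite -/(disj_set _ _).
have len (l u : R) :
    (if (l < u)%R then u%:E - l%:E else 0)%E = (Num.max 0 (u - l))%:E.
  have [lu|ul] := ltP l u; first by rewrite max_r ?subr_ge0 ?ltW// EFinB.
  by rewrite max_l// subr_le0.
have leb1 : leb J1 = _ := lebesgue_measure_itv _.
have leb2 : leb J2 = _ := lebesgue_measure_itv _.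
rewrite [X in (X + _)%E]leb1 [X in (_ + X)%E]leb2 /= !lte_fin !len -EFinD.
by rewrite diamond_arc_lengths.
Qed.

Lemma diamond_transportE mu nu (X : set plane) : measurable X ->
  diamond_transport mu nu X =
  leb ([set t | X (quantile_pair mu nu (diamond_curve t))] `&` `[0, 1]).
Proof.
move=> mX; rewrite -uniform01E// -[X in measurable X]setTI.
have mq := measurable_quantile_pair mu nu.
have mc := @measurable_diamond_curve R.
exact: (measurableT_comp mq mc measurableT mX).
Qed.

Lemma cdf1_itv mu s : 0 <= cdf1 mu s <= 1.
Proof.
by rewrite -!lee_fin -cdf1E measure_ge0/= probability_le1.
Qed.

Lemma quantile_le_cdf1 mu s (u : R) : 0 < u < 1 -> quantile mu u <= s <-> u <= cdf1 mu s.
Proof. by move=> u01; rewrite quantile_le// cdf1E lee_fin. Qed.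

Lemma cdf2_diamond_transport mu nu s t :
  cdf2 (diamond_transport mu nu) s t = diamond_copula (cdf1 mu s) (cdf1 nu t).
Proof.
apply: EFin_inj; rewrite -cdf2E diamond_transportE; last exact: measurable_quadrant.
rewrite -(@diamond_curve_quadrant (fun u => quantile mu u <= s)
  (fun v => quantile nu v <= t)) ?cdf1_itv//.
- by move=> u u01; exact: quantile_le_cdf1.
- by move=> u u01; exact: quantile_le_cdf1.
have mq := measurable_quantile_pair mu nu.
have mc := @measurable_diamond_curve R.
rewrite -[X in measurable X]setTI.
exact: (measurableT_comp mq mc measurableT (measurable_quadrant s t)).
Qed.

Lemma diamond_copulax1 (a : R) : 0 <= a -> diamond_copula a 1 = a.
Proof. by move=> a0; rewrite /diamond_copula addrK (max_r a0) max_l// !ge_min lexx. Qed.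

Lemma diamond_copula1x (b : R) : 0 <= b -> diamond_copula 1 b = b.
Proof.
move=> b0; rewrite /diamond_copula (addrC 1 b) addrK (max_r b0) max_l//.
by rewrite !ge_min lexx orbT.
Qed.

Lemma diamond_transport_coupling mu nu : couplings mu nu (diamond_transport mu nu).
Proof.
have mq := measurable_quantile_pair mu nu.
have mc := @measurable_diamond_curve R.
split.
- pose X : {mfun plane >-> line} := HB.pack (fst : plane -> line)
    (@isMeasurableFun.Build _ _ plane line fst measurable_fst).
  apply: (@probability_eq_of_cdf (distribution (diamond_transport mu nu) X) mu) => s.
  rewrite [RHS]cdf1E [LHS]diamond_transportE; last first.
    by rewrite -[X in measurable X]setTI; exact: measurable_fst.
  rewrite -[cdf1 mu s]diamond_copulax1; last by have /andP[] := cdf1_itv mu s.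
  rewrite -(@diamond_curve_quadrant (fun u => quantile mu u <= s)
    (fun v => True)) ?cdf1_itv//; first last.
  + rewrite -[X in measurable X]setTI.
    have := measurableT_comp mq mc measurableT (measurable_fst_le s).
    by congr (measurable _); apply/seteqP; split=> u /=; [move=> [_ ?]|move=> [_ []]].
  + by move=> v /andP[_ /ltW ->].
  + by move=> u u01; exact: quantile_le_cdf1.
  + by rewrite ler01 lexx.
  congr (leb _); apply/seteqP; split=> u /=; rewrite !in_itv/=; first by move=> [].
  by move=> [[]].
- pose X : {mfun plane >-> line} := HB.pack (snd : plane -> line)
    (@isMeasurableFun.Build _ _ plane line snd measurable_snd).
  apply: (@probability_eq_of_cdf (distribution (diamond_transport mu nu) X) nu) => s.
  rewrite [RHS]cdf1E [LHS]diamond_transportE; last first.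
    by rewrite -[X in measurable X]setTI; exact: measurable_snd.
  rewrite -[cdf1 nu s]diamond_copula1x; last by have /andP[] := cdf1_itv nu s.
  rewrite -(@diamond_curve_quadrant (fun u => True)
    (fun v => quantile nu v <= s)) ?cdf1_itv//; first last.
  + rewrite -[X in measurable X]setTI.
    have := measurableT_comp mq mc measurableT (measurable_snd_le s).
    by congr (measurable _); apply/seteqP; split=> u /=; [move=> [_ ?]|move=> [_ []]].
  + by move=> u u01; exact: quantile_le_cdf1.
  + by move=> v /andP[_ /ltW ->].
  + by rewrite ler01 lexx.
  congr (leb _); apply/seteqP; split=> u /=; rewrite !in_itv/=; first by move=> [].
  by move=> [[]].
Qed.

End DiamondTransport.

(** * First-order expansion of the objective *)

Section Expansion.
Context {R : realType}.
Local Notation line := (measurableTypeR R).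
Local Notation plane := (measurableTypeR R * measurableTypeR R)%type.
Implicit Types (mu nu : probR R) (pi : probR2 R).

Lemma coupling_integral_fst mu nu pi (f : line -> \bar R) : couplings mu nu pi ->
  measurable_fun setT f -> (forall x, 0 <= f x)%E ->
  (\int[pi]_z f z.1 = \int[mu]_x f x)%E.
Proof.
move=> [p1 _] mf f0.
have mfst : measurable_fun setT (fst : plane -> line) := measurable_fst.
rewrite -(ge0_integral_pushforward mfst pi measurableT mf)//.
by apply: eq_measure_integral => A mA _; exact: p1.
Qed.

Lemma coupling_integral_snd mu nu pi (f : line -> \bar R) : couplings mu nu pi ->
  measurable_fun setT f -> (forall x, 0 <= f x)%E ->
  (\int[pi]_z f z.2 = \int[nu]_x f x)%E.
Proof.
move=> [_ p2] mf f0.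
have msnd : measurable_fun setT (snd : plane -> line) := measurable_snd.
rewrite -(ge0_integral_pushforward msnd pi measurableT mf)//.
by apply: eq_measure_integral => A mA _; exact: p2.
Qed.

Lemma integral_product_fst pi (f : plane -> \bar R) :
  measurable_fun setT f -> (forall x, 0 <= f x)%E ->
  (\int[pi \x pi]_p f p.1 = \int[pi]_z f z)%E.
Proof.
move=> mf f0; rewrite (fubini_tonelli1 (m1 := pi) (m2 := pi))//; last first.
  exact: (measurableT_comp mf measurable_fst).
apply: eq_integral => z _; rewrite /fubini_F/= integral_cst//.
by rewrite [X in (_ * X)%E]probability_setT mule1.
Qed.

Lemma integral_product_snd pi (f : plane -> \bar R) :
  measurable_fun setT f -> (forall x, 0 <= f x)%E ->
  (\int[pi \x pi]_p f p.2 = \int[pi]_z f z)%E.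
Proof.
move=> mf f0; rewrite (fubini_tonelli1 (m1 := pi) (m2 := pi))//; last first.
  exact: (measurableT_comp mf measurable_snd).
rewrite /fubini_F/= integral_cst//.
by rewrite [X in (_ * X)%E]probability_setT mule1.
Qed.

(** A bound that involves one of the two points at a time reduces an integral over
    independent pairs to an integral over single points. *)
Lemma product_integral_le pi (f : plane * plane -> R) (g : plane -> R) :
  measurable_fun setT f -> measurable_fun setT g ->
  (forall p, 0 <= f p) -> (forall z, 0 <= g z) ->
  (forall p, f p <= g p.1 + g p.2) ->
  (\int[pi \x pi]_p (f p)%:E <= \int[pi]_z (g z)%:E + \int[pi]_z (g z)%:E)%E.
Proof.
move=> mf mg f0 g0 fg.
have mEg : measurable_fun setT (EFin \o g) by exact/measurable_EFinP.
have Eg0 z : (0 <= (EFin \o g) z)%E by rewrite lee_fin.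
rewrite -[X in (X + _)%E](integral_product_fst pi mEg Eg0).
rewrite -[X in (_ + X)%E](integral_product_snd pi mEg Eg0).
rewrite -ge0_integralD//; first last.
- exact: (measurableT_comp mEg measurable_snd).
- exact: (measurableT_comp mEg measurable_fst).
apply: ge0_le_integral => //.
- by move=> p _; rewrite lee_fin.
- exact/measurable_EFinP.
- by apply: emeasurable_funD; apply: (measurableT_comp mEg).
- by move=> p _; rewrite -EFinD lee_fin.
Qed.

Lemma measurable_dist1 : measurable_fun setT (fun p : plane * plane => `|p.1.1 - p.2.1|).
Proof.
apply: measurableT_comp => //; apply: measurable_funB.
  exact: measurable_coord11.
exact: measurable_coord21.
Qed.

Lemma measurable_dist2 : measurable_fun setT (fun p : plane * plane => `|p.1.2 - p.2.2|).
Proof.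
apply: measurableT_comp => //; apply: measurable_funB.
  exact: measurable_coord12.
exact: measurable_coord22.
Qed.

Definition damped_kernel (gamma : R) (p : plane * plane) : R :=
  `|p.1.2 - p.2.2| * expR (- (gamma * `|p.1.1 - p.2.1|)).

Lemma measurable_damped_kernel gamma : measurable_fun setT (damped_kernel gamma).
Proof.
apply: measurable_funM; first exact: measurable_dist2.
apply: measurableT_comp => //; apply: measurableT_comp => //.
by apply: measurable_funM => //; exact: measurable_dist1.
Qed.

Lemma objectiveE gamma pi :
  objective gamma pi = (\int[pi \x pi]_p (damped_kernel gamma p)%:E)%E.
Proof.
rewrite (fubini_tonelli1 (m1 := pi) (m2 := pi)); last 2 first.
- by apply/measurable_EFinP; exact: measurable_damped_kernel.
- by move=> p; rewrite lee_fin mulr_ge0 ?expR_ge0.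
apply: eq_integral => w _; apply: eq_integral => z _.
by rewrite /damped_kernel/= (distrC z.2) (distrC z.1).
Qed.

(** The value of the objective at [gamma = 0] is the same for all couplings; the
    maximization is thus decided by the next order in [gamma]. *)
Lemma mean_distance_coupling mu nu pi : couplings mu nu pi ->
  (\int[pi \x pi]_p `|p.1.2 - p.2.2|%:E =
   \int[nu]_y \int[nu]_y' `|y - y'|%:E)%E.
Proof.
move=> cpl; rewrite (fubini_tonelli1 (m1 := pi) (m2 := pi)); last 2 first.
- by apply/measurable_EFinP; exact: measurable_dist2.
- by move=> p; rewrite lee_fin.
have md : measurable_fun setT (fun p : plane => `|p.1 - p.2|%:E).
  by apply/measurable_EFinP/measurableT_comp => //; apply: measurable_funB.
rewrite /fubini_F/=.
transitivity (\int[pi]_x \int[nu]_y `|x.2 - y|%:E)%E.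
  apply: eq_integral => x _; apply: (coupling_integral_snd (f := fun y => `|x.2 - y|%:E) cpl) => //.
  by apply/measurable_EFinP/measurableT_comp => //; apply: measurable_funB.
apply: (coupling_integral_snd (f := fun x => (\int[nu]_y `|x - y|%:E)%E) cpl).
- by have := measurable_fun_fubini_tonelli_F (m2 := nu) _ md; apply.
- by move=> x; apply: integral_ge0.
Qed.

(** A bound for [r - (1 - exp (- gamma * r)) / gamma], the error made when replacing
    the damped kernel by its first-order expansion: at most [r] for all [r], which
    gives a dominating function, and small when [gamma] is. *)
Definition expansion_error (gamma r : R) : R := Num.min r (gamma * r ^+ 2).

Lemma expansion_error_ge0 (gamma r : R) : 0 <= gamma -> 0 <= r -> 0 <= expansion_error gamma r.
Proof. by move=> g0 r0; rewrite /expansion_error le_min r0 mulr_ge0// sqr_ge0. Qed.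

Lemma expansion_error_nondecreasing (gamma r s : R) : 0 <= gamma -> 0 <= r -> r <= s ->
  expansion_error gamma r <= expansion_error gamma s.
Proof.
move=> g0 r0 rs; rewrite /expansion_error le_min !ge_min rs/=; apply/orP; right.
by rewrite ler_wpM2l// ler_sqr ?nnegrE// (le_trans r0).
Qed.

Lemma expR_expansion_error (gamma r : R) : 0 < gamma -> 0 <= r ->
  expR (- (gamma * r)) + gamma * r <= 1 + gamma * expansion_error gamma r.
Proof.
move=> g0 r0; have u0 : 0 <= gamma * r by rewrite mulr_ge0// ltW.
rewrite /expansion_error minEle; case: ifP => _.
  by rewrite lerD2r -[leRHS]expR0 ler_expR oppr_le0.
rewrite mulrA -expr2 -exprMn; move: (gamma * r) u0 => u u0.
(* [exp (- u) <= 1 / (1 + u) <= 1 - u + u ^ 2]. *)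
have e1 : expR (- u) * (1 + u) <= 1.
  rewrite -[leRHS](expRxMexpNx_1 u) mulrC ler_pM2r ?expR_gt0//; exact: expR_ge1Dx.
have : expR (- u) * (1 + u) <= (1 - u + u ^+ 2) * (1 + u).
  apply: (le_trans e1); rewrite -subr_ge0 (_ : _ - _ = u ^+ 3); last by ring.
  exact: exprn_ge0.
by rewrite ler_pM2r; lra.
Qed.

(** Young's inequality replaces the product by a sum of functions of single
    coordinates; [|x - x'|] is at most twice the larger of [|x|] and [|x'|], and the
    error is monotone. *)
Lemma weighted_expansion_error (gamma eps x x' y y' : R) : 0 < gamma -> 0 < eps ->
  `|y - y'| * expansion_error gamma `|x - x'| <=
  eps * (y ^+ 2 + y' ^+ 2) +
  eps^-1 * (expansion_error gamma (2 * `|x|) ^+ 2 + expansion_error gamma (2 * `|x'|) ^+ 2).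
Proof.
move=> g0 e0; set k := expansion_error gamma (2 * _); set k' := expansion_error gamma (2 * `|x'|).
have kk : expansion_error gamma `|x - x'| <= k + k'.
  have xx := ler_normB x x'.
  have k0 : 0 <= k by rewrite expansion_error_ge0 ?(ltW g0)// mulr_ge0.
  have k'0 : 0 <= k' by rewrite expansion_error_ge0 ?(ltW g0)// mulr_ge0.
  have [h|h] := leP `|x| `|x'|.
    apply: (@le_trans _ _ k'); last by rewrite lerDr.
    by apply: expansion_error_nondecreasing => //; [exact: ltW|lra].
  apply: (@le_trans _ _ k); last by rewrite lerDl.
  by apply: expansion_error_nondecreasing => //; [exact: ltW|lra].
have yy := ler_normB y y'.
apply: (@le_trans _ _ ((`|y| + `|y'|) * (k + k'))).
  by rewrite ler_pM// expansion_error_ge0// ltW.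
rewrite -(real_normK (num_real y)) -(real_normK (num_real y')).
move: (`|y|) (`|y'|) k k' {kk yy} => a b k k'.
rewrite -subr_ge0.
rewrite (_ : _ - _ = (2 * eps)^-1 * ((eps * (a + b) - (k + k')) ^+ 2
   + eps ^+ 2 * (a - b) ^+ 2 + (k - k') ^+ 2)); last by field; exact: lt0r_neq0.
apply: mulr_ge0; first by rewrite invr_ge0 mulr_ge0// ltW.
by apply: addr_ge0 (sqr_ge0 _); apply: addr_ge0 (sqr_ge0 _) _; apply: mulr_ge0; exact: sqr_ge0.
Qed.

Lemma measurable_interaction_kernel :
  measurable_fun setT (interaction_kernel : plane * plane -> R).
Proof. by apply: measurable_funM; [exact: measurable_dist1|exact: measurable_dist2]. Qed.

Lemma measurable_expansion_error_sqr gamma :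
  measurable_fun [set: line] (fun x : line => expansion_error gamma (2 * `|x|) ^+ 2 : line).
Proof.
have m2 : measurable_fun [set: line] (fun x : line => 2 * `|x| : line).
  by apply: measurable_funM => //; exact: measurableT_comp.
apply: measurable_funX; apply: measurable_minr => //.
by apply: measurable_funM => //; exact: measurable_funX.
Qed.

(** The right-hand side does not depend on the coupling: the expansion error is
    uniform over all couplings of [mu] and [nu]. *)
Lemma integral_weighted_error mu nu pi gamma eps : couplings mu nu pi ->
  0 < gamma -> 0 < eps ->
  (\int[pi \x pi]_p
     (`|p.1.2 - p.2.2| * expansion_error gamma `|p.1.1 - p.2.1|)%:E <=
   (2 * eps)%:E * \int[nu]_y (y ^+ 2)%:E +
   (2 * eps^-1)%:E * \int[mu]_x (expansion_error gamma (2 * `|x|) ^+ 2)%:E)%E.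
Proof.
move=> cpl g0 e0.
set k := fun x : R => expansion_error gamma (2 * `|x|) ^+ 2.
have mk : measurable_fun [set: line] (k : line -> line) by exact: measurable_expansion_error_sqr.
have ms : measurable_fun [set: line] (fun y : line => y ^+ 2 : line) by exact: measurable_funX.
pose g (z : plane) := eps * z.2 ^+ 2 + eps^-1 * k z.1.
have k0 x : 0 <= k x by exact: sqr_ge0.
have g0' z : 0 <= g z.
  apply: addr_ge0; first by apply: mulr_ge0; [exact: ltW|exact: sqr_ge0].
  by apply: mulr_ge0 => //; rewrite invr_ge0 ltW.
have mg1 : measurable_fun setT (fun z : plane => eps * z.2 ^+ 2).
  by apply: measurable_funM => //; exact: (measurableT_comp ms measurable_snd).
have mg2 : measurable_fun setT (fun z : plane => eps^-1 * k z.1).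
  by apply: measurable_funM => //; exact: (measurableT_comp mk measurable_fst).
have mg : measurable_fun setT g by exact: measurable_funD.
apply: (le_trans (product_integral_le pi _ mg _ g0' _)).
- apply: measurable_funM; first exact: measurable_dist2.
  apply: measurable_minr; first exact: measurable_dist1.
  by apply: measurable_funM => //; apply: measurable_funX; exact: measurable_dist1.
- by move=> p; rewrite mulr_ge0// expansion_error_ge0// ltW.
- move=> p; apply: (le_trans (weighted_expansion_error _ _ _ _ g0 e0)).
  by rewrite /g /k; lra.
have -> : (\int[pi]_z (g z)%:E =
    eps%:E * \int[nu]_y (y ^+ 2)%:E + eps^-1%:E * \int[mu]_x (k x)%:E)%E.
  under eq_integral do rewrite /= EFinD.
  rewrite ge0_integralD//; first last.
  - exact/measurable_EFinP.
  - by move=> z _; rewrite lee_fin mulr_ge0// invr_ge0 ltW.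
  - exact/measurable_EFinP.
  - by move=> z _; rewrite lee_fin; apply: mulr_ge0; [exact: ltW|exact: sqr_ge0].
  under eq_integral do rewrite EFinM.
  under [X in (_ + X)%E]eq_integral do rewrite EFinM.
  rewrite !ge0_integralZl//; last 6 first.
  - by apply/measurable_EFinP; exact: (measurableT_comp mk measurable_fst).
  - by move=> z _; rewrite lee_fin.
  - by rewrite lee_fin invr_ge0 ltW.
  - by apply/measurable_EFinP; exact: (measurableT_comp ms measurable_snd).
  - by move=> z _; rewrite lee_fin sqr_ge0.
  - by rewrite lee_fin ltW.
  rewrite (coupling_integral_snd (f := fun y => (y ^+ 2)%:E) cpl)//; last 2 first.
  - exact/measurable_EFinP.
  - by move=> y; rewrite lee_fin sqr_ge0.
  rewrite (coupling_integral_fst (f := fun x => (k x)%:E) cpl)//.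
  exact/measurable_EFinP.
rewrite addeACA -!ge0_muleDl ?lee_fin ?invr_ge0 ?(ltW e0)// -!EFinD.
by rewrite -!mulr2n !mulr_natl.
Qed.

End Expansion.

(** * Mean-square convergence of joint distribution functions *)

Section Limit.
Context {R : realType}.
Local Notation line := (measurableTypeR R).
Local Notation plane := (measurableTypeR R * measurableTypeR R)%type.
Local Notation leb := (@lebesgue_measure R).
Implicit Types (mu nu : probR R) (pi : probR2 R).

Lemma measurable_sqr : measurable_fun [set: line] (fun y : line => y ^+ 2 : line).
Proof. exact: measurable_funX. Qed.

Lemma ge0_integralDZ d (T : measurableType d) (m : {measure set T -> \bar R})
    (f g : T -> R) (c : R) :
  measurable_fun setT f -> measurable_fun setT g ->
  (forall x, 0 <= f x) -> (forall x, 0 <= g x) -> 0 <= c ->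
  (\int[m]_x (f x)%:E + c%:E * \int[m]_x (g x)%:E =
   \int[m]_x (f x + c * g x)%:E)%E.
Proof.
move=> mf mg f0 g0 c0.
have Ef : measurable_fun setT (fun x => (f x)%:E) by exact/measurable_EFinP.
have Eg : measurable_fun setT (fun x => (g x)%:E) by exact/measurable_EFinP.
have Ef0 x : (0 <= (f x)%:E)%E by rewrite lee_fin.
have Eg0 x : (0 <= (g x)%:E)%E by rewrite lee_fin.
rewrite -ge0_integralZl//.
rewrite -ge0_integralD//; last by apply: measurable_funeM.
by move=> x _; rewrite mule_ge0.
Qed.

Lemma ge0_le_integral_EFin d (T : measurableType d) (m : {measure set T -> \bar R})
    (f g : T -> R) :
  measurable_fun setT f -> measurable_fun setT g ->
  (forall x, 0 <= f x) -> (forall x, f x <= g x) ->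
  (\int[m]_x (f x)%:E <= \int[m]_x (g x)%:E)%E.
Proof.
move=> mf mg f0 fg; apply: ge0_le_integral => //.
- by move=> x _; rewrite lee_fin.
- exact/measurable_EFinP.
- exact/measurable_EFinP.
- by move=> x _; rewrite lee_fin.
Qed.

Lemma finite_second_moment mu (p : R) : 2 <= p -> finite_abs_moment mu p ->
  (\int[mu]_x (x ^+ 2)%:E < +oo)%E.
Proof.
move=> p2; rewrite /finite_abs_moment => fin.
have mp : measurable_fun [set: line] (fun x : line => `|x| `^ p : line).
  by apply: (measurableT_comp (measurable_powR p)) => //; exact: measurableT_comp.
apply: (@le_lt_trans _ _ (\int[mu]_x (1 + (`|x| `^ p)%:E))%E).
  apply: ge0_le_integral => //.
  - by move=> x _; rewrite lee_fin sqr_ge0.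
  - by apply/measurable_EFinP; exact: measurable_sqr.
  - by apply: emeasurable_funD => //; exact/measurable_EFinP.
  - move=> x _; rewrite -EFinD lee_fin -(real_normK (num_real x)) -powR_mulrn//.
    have [x1|x1] := leP 1 `|x|.
      by apply: (@le_trans _ _ (`|x| `^ p)); [exact: ler_powR|rewrite lerDr].
    rewrite (@le_trans _ _ 1) ?lerDl ?powR_ge0// powR_mulrn//.
    by rewrite exprn_ile1// ltW.
rewrite ge0_integralD//; last exact/measurable_EFinP.
rewrite integral_cst// mul1e lte_add_pinfty//.
by rewrite (le_lt_trans (probability_le1 _ _)) ?ltry.
Qed.

Lemma mean_distance_lty mu nu pi : couplings mu nu pi ->
  (\int[nu]_y (y ^+ 2)%:E < +oo)%E ->
  (\int[pi \x pi]_p `|p.1.2 - p.2.2|%:E < +oo)%E.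
Proof.
move=> cpl fin.
have ms := measurableT_comp measurable_sqr
  (measurable_snd : measurable_fun setT (snd : plane -> line)).
apply: (le_lt_trans (product_integral_le (g := fun z => 1 + z.2 ^+ 2) pi _ _ _ _ _)).
- exact: measurable_dist2.
- by apply: measurable_funD => //; exact: measurable_cst.
- by [].
- by move=> z; rewrite addr_ge0// sqr_ge0.
- move=> p; apply: (le_trans (ler_normB _ _)).
  have h (y : R) : `|y| <= 1 + y ^+ 2.
    by rewrite -(real_normK (num_real y)); have := sqr_ge0 (`|y| - 1 / 2); lra.
  by rewrite lerD.
have -> : (\int[pi]_z (1 + z.2 ^+ 2)%:E = 1 + \int[nu]_y (y ^+ 2)%:E)%E.
  under eq_integral do rewrite EFinD.
  rewrite ge0_integralD//; last 2 first.
  - by move=> z _; rewrite lee_fin sqr_ge0.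
  - exact/measurable_EFinP.
  rewrite integral_cst// [X in (_ * X + _)%E]probability_setT mule1.
  rewrite (coupling_integral_snd (f := fun y => (y ^+ 2)%:E) cpl)//.
  - by apply/measurable_EFinP; exact: measurable_sqr.
  - by move=> y; rewrite lee_fin sqr_ge0.
have lt1 : (1 < +oo :> \bar R)%E by exact: ltry.
by apply: lte_add_pinfty; exact: lte_add_pinfty.
Qed.

Lemma interaction_lty mu nu pi : couplings mu nu pi ->
  (\int[mu]_x (x ^+ 2)%:E < +oo)%E -> (\int[nu]_y (y ^+ 2)%:E < +oo)%E ->
  (interaction pi < +oo)%E.
Proof.
move=> cpl fin1 fin2.
have ms1 := measurableT_comp measurable_sqr
  (measurable_fst : measurable_fun setT (fst : plane -> line)).
have ms2 := measurableT_comp measurable_sqr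
  (measurable_snd : measurable_fun setT (snd : plane -> line)).
apply: (le_lt_trans (product_integral_le (g := fun z => z.1 ^+ 2 + z.2 ^+ 2) pi _ _ _ _ _)).
- exact: measurable_interaction_kernel.
- by apply: measurable_funD => //; exact: measurable_cst.
- by move=> p; rewrite mulr_ge0.
- by move=> z; rewrite addr_ge0// sqr_ge0.
- move=> p; apply: (@le_trans _ _ ((`|p.1.1| + `|p.2.1|) * (`|p.1.2| + `|p.2.2|))).
    by rewrite ler_pM// ler_normB.
  rewrite -(real_normK (num_real p.1.1)) -(real_normK (num_real p.1.2)).
  rewrite -(real_normK (num_real p.2.1)) -(real_normK (num_real p.2.2)).
  move: `|p.1.1| `|p.1.2| `|p.2.1| `|p.2.2| => a b c d.
  have := sqr_ge0 (a - c); have := sqr_ge0 (b - d).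
  have := sqr_ge0 (a + c - b - d); lra.
have -> : (\int[pi]_z (z.1 ^+ 2 + z.2 ^+ 2)%:E =
    \int[mu]_x (x ^+ 2)%:E + \int[nu]_y (y ^+ 2)%:E)%E.
  under eq_integral do rewrite EFinD.
  rewrite ge0_integralD//; last 4 first.
  - by move=> z _; rewrite lee_fin sqr_ge0.
  - exact/measurable_EFinP.
  - by move=> z _; rewrite lee_fin sqr_ge0.
  - exact/measurable_EFinP.
  rewrite (coupling_integral_fst (f := fun x => (x ^+ 2)%:E) cpl); first last.
  - by move=> y; rewrite lee_fin sqr_ge0.
  - by apply/measurable_EFinP; exact: measurable_sqr.
  rewrite (coupling_integral_snd (f := fun y => (y ^+ 2)%:E) cpl)//.
  - by apply/measurable_EFinP; exact: measurable_sqr.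
  - by move=> y; rewrite lee_fin sqr_ge0.
by apply: lte_add_pinfty; exact: lte_add_pinfty.
Qed.

(** With [J] the objective, [K] the interaction, [E] the error and [M] the mean
    distance, [J pi + gamma * K pi <= M + gamma * E pi] for every coupling, while
    [M <= J pi0 + gamma * K pi0]; [M] is common to both couplings. *)
Lemma interaction_le_of_objective mu nu pi pi0 (gamma : R) :
  couplings mu nu pi -> couplings mu nu pi0 -> 0 < gamma ->
  (\int[mu]_x (x ^+ 2)%:E < +oo)%E -> (\int[nu]_y (y ^+ 2)%:E < +oo)%E ->
  (objective gamma pi0 <= objective gamma pi)%E ->
  (interaction pi <= interaction pi0 + \int[pi \x pi]_p
     (`|p.1.2 - p.2.2| * expansion_error gamma `|p.1.1 - p.2.1|)%:E)%E.
Proof.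
move=> cpl cpl0 g0 fin1 fin2; rewrite !objectiveE.
set J0 := (\int[pi0 \x pi0]_p (damped_kernel gamma p)%:E)%E.
set J := (\int[pi \x pi]_p (damped_kernel gamma p)%:E)%E.
set err := fun p : plane * plane => `|p.1.2 - p.2.2| * expansion_error gamma `|p.1.1 - p.2.1|.
set E := (\int[pi \x pi]_p (err p)%:E)%E => J0J.
change (interaction pi <= interaction pi0 + E)%E.
have merr : measurable_fun setT err.
  apply: measurable_funM; first exact: measurable_dist2.
  apply: measurable_minr; first exact: measurable_dist1.
  by apply: measurable_funM => //; apply: measurable_funX; exact: measurable_dist1.
have mJ := measurable_damped_kernel gamma.
have mK := measurable_interaction_kernel.
have md := measurable_dist2.
have J_ge0 p : 0 <= damped_kernel gamma p by rewrite mulr_ge0 ?expR_ge0.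
have K_ge0 (p : plane * plane) : 0 <= interaction_kernel p by rewrite mulr_ge0.
have err_ge0 p : 0 <= err p by rewrite mulr_ge0// expansion_error_ge0// ltW.
pose M := (\int[pi \x pi]_p `|p.1.2 - p.2.2|%:E)%E.
have M0 : (\int[pi0 \x pi0]_p `|p.1.2 - p.2.2|%:E = M)%E.
  by rewrite /M (mean_distance_coupling cpl) (mean_distance_coupling cpl0).
have up : (J + gamma%:E * interaction pi <= M + gamma%:E * E)%E.
  rewrite /interaction ge0_integralDZ ?(ltW g0)// ge0_integralDZ ?(ltW g0)//.
  apply: ge0_le_integral_EFin.
  - by apply: measurable_funD => //; exact: measurable_funM.
  - by apply: measurable_funD => //; exact: measurable_funM.
  - move=> p; apply: addr_ge0; first exact: J_ge0.
    by apply: mulr_ge0; [exact: ltW|exact: K_ge0].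
  move=> p; have := expR_expansion_error g0 (normr_ge0 (p.1.1 - p.2.1)).
  move=> /(ler_wpM2l (normr_ge0 (p.1.2 - p.2.2))).
  by rewrite /damped_kernel /interaction_kernel /err !mulrDr mulr1; lra.
have dn : (M <= J0 + gamma%:E * interaction pi0)%E.
  rewrite -M0 /interaction ge0_integralDZ ?(ltW g0)//.
  apply: ge0_le_integral_EFin => //.
    by apply: measurable_funD => //; exact: measurable_funM.
  move=> p; have := expR_ge1Dx (- (gamma * `|p.1.1 - p.2.1|)).
  rewrite lerBlDr => /(ler_wpM2l (normr_ge0 (p.1.2 - p.2.2))).
  by rewrite /damped_kernel /interaction_kernel mulrDr mulr1; lra.
have K0 : (interaction pi0 < +oo)%E := interaction_lty cpl0 fin1 fin2.
have Mlty : (M < +oo)%E := mean_distance_lty cpl fin2.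
have JM : (J <= M)%E.
  apply: ge0_le_integral_EFin => // p; rewrite /damped_kernel ler_piMr//.
  by rewrite -expR0 ler_expR oppr_le0 mulr_ge0// ltW.
have I0 : (0 <= interaction pi0)%E by apply: integral_ge0 => p _; rewrite lee_fin.
have J0_ge0 : (0 <= J0)%E by apply: integral_ge0 => p _; rewrite lee_fin.
have J0fin : J0 \is a fin_num.
  by rewrite ge0_fin_numE// (le_lt_trans J0J)// (le_lt_trans JM).
suff : (gamma%:E * interaction pi <= gamma%:E * (interaction pi0 + E))%E.
  by rewrite lee_pmul2l// lte_fin.
have E0 : (0 <= E)%E by apply: integral_ge0 => p _; rewrite lee_fin.
rewrite (ge0_muleDr _ I0 E0).
rewrite -(leeD2lE _ _ J0fin) (addeA J0).
apply: (@le_trans _ _ (J + gamma%:E * interaction pi)%E); first exact: leeD2r.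
by apply: (le_trans up); exact: leeD2r.
Qed.

(** Dominated convergence with dominating function [4 * x ^ 2], along sequences
    tending to [0] from the right. *)
Lemma expansion_error_cvg mu (e : R) : 0 < e ->
  (\int[mu]_x (x ^+ 2)%:E < +oo)%E ->
  \forall gamma \near (0 : R)^'+,
    (\int[mu]_x (expansion_error gamma (2 * `|x|) ^+ 2)%:E <= e%:E)%E.
Proof.
move=> e0 fin.
pose k gamma (x : R) := expansion_error gamma (2 * `|x|) ^+ 2.
have mk gamma : measurable_fun [set: line] (k gamma : line -> line).
  exact: measurable_expansion_error_sqr.
have k_ge0 gamma x : 0 <= k gamma x by exact: sqr_ge0.
have k_le gamma x : 0 < gamma -> k gamma x <= 4 * x ^+ 2.
  move=> g0; rewrite (_ : 4 * _ = (2 * `|x|) ^+ 2); last first.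
    by rewrite exprMn (real_normK (num_real x)) -natrX.
  rewrite /k ler_sqr ?nnegrE ?mulr_ge0//; last by rewrite expansion_error_ge0 ?mulr_ge0// ltW.
  by rewrite /expansion_error ge_min lexx.
have fin4 : (\int[mu]_x (4 * x ^+ 2)%:E < +oo)%E.
  under eq_integral do rewrite EFinM.
  rewrite ge0_integralZl//; last 2 first.
  - by apply/measurable_EFinP; exact: measurable_sqr.
  - by move=> x _; rewrite lee_fin sqr_ge0.
  by rewrite lte_mul_pinfty// lee_fin.
have m4 : measurable_fun [set: line] (fun x : line => (4 * x ^+ 2)%:E).
  by apply/measurable_EFinP/measurable_funM => //; exact: measurable_sqr.
have cvg0 : fine (\int[mu]_x (k gamma x)%:E) @[gamma --> (0 : R)^'+] --> (0 : R).
  apply/cvg_at_rightP => u [u0 uc].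
  have : (\int[mu]_x (k (u n) x)%:E @[n --> \oo] --> \int[mu]_(x in setT) (cst 0 x))%E.
    apply: (@dominated_cvg _ _ _ mu setT measurableT
      (fun n x => (k (u n) x)%:E) (cst 0%E) (fun x => (4 * x ^+ 2)%:E)).
    - by move=> n; apply/measurable_EFinP; exact: mk.
    - move=> x _; apply: cvg_EFin; first exact: nearW.
      apply: (@squeeze_cvgr _ _ _ _ (cst 0) (fun n => (u n * (2 * `|x|) ^+ 2) ^+ 2)).
      + near=> n; rewrite k_ge0/= /k ler_sqr ?nnegrE ?mulr_ge0 ?sqr_ge0 ?(ltW (u0 _))//.
          by rewrite /expansion_error ge_min lexx orbT.
        by rewrite expansion_error_ge0 ?mulr_ge0// ltW.
      + exact: cvg_cst.
      + rewrite [X in _ --> X](_ : _ =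
            (0 * (2 * `|x|) ^+ 2) * (0 * (2 * `|x|) ^+ 2)); last by rewrite !mul0r.
        have ucx : u n * (2 * `|x|) ^+ 2 @[n --> \oo] --> 0 * (2 * `|x|) ^+ 2.
          by apply: (cvgM uc); exact: cvg_cst.
        exact: (cvgM ucx ucx).
    - by [].
    - apply/integrableP; split=> //.
      rewrite (eq_integral (fun x : line => (4 * x ^+ 2)%:E))// => x _.
      by rewrite gee0_abs// lee_fin mulr_ge0// sqr_ge0.
    - by move=> n x _; rewrite gee0_abs ?lee_fin// k_le.
  by rewrite integral0 => /fine_cvg.
near=> gamma.
rewrite -[leLHS]fineK; last first.
  rewrite ge0_fin_numE; last by apply: integral_ge0 => x _; rewrite lee_fin sqr_ge0.
  apply: le_lt_trans fin4; apply: ge0_le_integral_EFin => //.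
  - exact: mk.
  - by apply: measurable_funM => //; exact: measurable_sqr.
  - by move=> x; exact: sqr_ge0.
  - by move=> x; apply: k_le; near: gamma; exact: nbhs_right_gt.
rewrite lee_fin; near: gamma.
exact: (cvgr_le _ cvg0).
Unshelve. all: by end_near. Qed.

(** The diamond transport competes with the maximizer, whose interaction is
    therefore at most that of the diamond transport up to the uniform expansion
    error; the energy gap bounds the mean-square distance. *)
Lemma cdf2_gap_cvg mu nu (pi : R -> probR2 R) (e : R) : 0 < e ->
  (\int[mu]_x (x ^+ 2)%:E < +oo)%E -> (\int[nu]_y (y ^+ 2)%:E < +oo)%E ->
  (forall gamma : R, 0 < gamma -> is_maximizer mu nu gamma (pi gamma)) ->
  \forall gamma \near (0 : R)^'+,
    (\int[leb \x leb]_p ((cdf2 (pi gamma) p.1 p.2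
       - cdf2 (diamond_transport mu nu) p.1 p.2) ^+ 2)%:E <= e%:E)%E.
Proof.
move=> e0 fin1 fin2 maxi; set pi0 := diamond_transport mu nu.
have cpl0 : couplings mu nu pi0 := diamond_transport_coupling mu nu.
have I2 : (0 <= \int[nu]_y (y ^+ 2)%:E)%E.
  by apply: integral_ge0 => y _; rewrite lee_fin sqr_ge0.
have [C C0 CE] : exists2 C : R, 0 <= C & (\int[nu]_y (y ^+ 2)%:E)%E = C%:E.
  exists (fine (\int[nu]_y (y ^+ 2)%:E)%E); first by rewrite fine_ge0.
  by rewrite fineK// ge0_fin_numE.
(* [eps] is chosen so that both error terms are at most [2 * e]. *)
pose eps := e / (C + 1).
have C1 : 0 < C + 1 by lra.
have eps0 : 0 < eps by rewrite divr_gt0.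
have K0fin : interaction pi0 \is a fin_num.
  rewrite ge0_fin_numE ?(interaction_lty cpl0)//.
  by apply: integral_ge0 => p _; rewrite lee_fin mulr_ge0.
near=> gamma.
have g0 : 0 < gamma by near: gamma; exact: nbhs_right_gt.
have [cpl opt] := maxi gamma g0.
have up := interaction_le_of_objective cpl cpl0 g0 fin1 fin2 (opt _ cpl0).
have err := integral_weighted_error cpl g0 eps0.
have kle : (\int[mu]_x (expansion_error gamma (2 * `|x|) ^+ 2)%:E <= (eps * e)%:E)%E.
  by near: gamma; apply: expansion_error_cvg => //; exact: mulr_gt0.
have dn := interaction_gap cpl cpl0 (cdf2_diamond_transport mu nu).
have := le_trans dn (le_trans up (leeD2l _ err)).
rewrite (leeD2lE _ _ K0fin) CE => main.
have : (4%:E * \int[leb \x leb]_p ((cdf2 (pi gamma) p.1 p.2 - cdf2 pi0 p.1 p.2) ^+ 2)%:E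
   <= 4%:E * e%:E)%E.
  apply: (le_trans main).
  apply: (@le_trans _ _ ((2 * eps)%:E * C%:E + (2 * eps^-1)%:E * (eps * e)%:E)%E).
    by apply: leeD2l; apply: lee_wpmul2l => //; rewrite lee_fin mulr_ge0// invr_ge0 ltW.
  rewrite -!EFinM -EFinD lee_fin.
  rewrite (_ : 2 * eps^-1 * _ = 2 * e); last by field; exact: lt0r_neq0.
  have : eps * C <= e by rewrite /eps mulrAC ler_pdivrMr//; nra.
  lra.
by rewrite lee_pmul2l// lte_fin.
Unshelve. all: by end_near. Qed.

End Limit.

(** * Pointwise convergence of joint distribution functions *)

Section WeakLimit.
Context {R : realType}.
Local Notation line := (measurableTypeR R).
Local Notation plane := (measurableTypeR R * measurableTypeR R)%type.
Local Notation leb := (@lebesgue_measure R).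
Implicit Types (mu nu : probR R) (pi : probR2 R).

Lemma cdf1_right_continuous mu (s e : R) : 0 < e ->
  exists2 h, 0 < h & cdf1 mu (s + h) - cdf1 mu s <= e.
Proof.
move=> e0; pose idR : line -> R := idfun.
pose X : {mfun line >-> R} :=
  HB.pack idR (@isMeasurableFun.Build _ _ _ _ idR (@measurable_id _ _ setT)).
pose F := cdf (X : {RV mu >-> R}).
have rc : cdf1 mu x @[x --> s^'+] --> cdf1 mu s.
  have rc' : fine (F x) @[x --> s^'+] --> fine (F s).
    apply: fine_cvg; rewrite fineK ?fin_num_measure//.
    exact: (@cdf_right_continuous _ _ _ mu X s).
  exact: rc'.
have [x [xs sx]] : exists x, cdf1 mu x <= cdf1 mu s + e /\ s < x.
  apply: (@filter_ex _ s^'+); near=> x; split.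
    by near: x; apply: (cvgr_le _ rc); lra.
  by near: x; exact: nbhs_right_gt.
exists (x - s); first by rewrite subr_gt0.
by rewrite subrKC; lra.
Unshelve. all: by end_near. Qed.

Lemma cdf1_tails mu (e : R) : 0 < e ->
  exists2 N, 0 < N & forall M, N <= M -> cdf1 mu (- M) <= e /\ 1 - e <= cdf1 mu M.
Proof.
move=> e0; pose idR : line -> R := idfun.
pose X : {mfun line >-> R} :=
  HB.pack idR (@isMeasurableFun.Build _ _ _ _ idR (@measurable_id _ _ setT)).
pose F := cdf (X : {RV mu >-> R}).
have cy : cdf1 mu x @[x --> +oo] --> (1 : R).
  have cy' : fine (F x) @[x --> +oo] --> (1 : R).
    by apply: fine_cvg; exact: (@cvg_cdfy1 _ _ _ mu X).
  exact: cy'.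
have cN : cdf1 mu x @[x --> -oo] --> (0 : R).
  have cN' : fine (F x) @[x --> -oo] --> (0 : R).
    by apply: fine_cvg; exact: (@cvg_cdfNy0 _ _ _ mu X).
  exact: cN'.
have [N1 N1P] : exists N1, cdf1 mu N1 <= e.
  by apply: (@filter_ex _ (-oo : set_system R)); exact: (cvgr_le _ cN).
have [N2 N2P] : exists N2, 1 - e <= cdf1 mu N2.
  by apply: (@filter_ex _ (+oo : set_system R)); apply: (cvgr_ge _ cy); lra.
exists (Num.max 1 (Num.max (- N1) N2)); first by rewrite lt_max ltr01.
move=> M; rewrite !ge_max => /and3P[_ h1 h2]; split.
  by apply: le_trans N1P; apply: cdf1_nondecreasing; lra.
by apply: (le_trans N2P); apply: cdf1_nondecreasing.
Qed.

Lemma cdf2_nondecreasing pi (s s' t t' : R) : s <= s' -> t <= t' ->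
  cdf2 pi s t <= cdf2 pi s' t'.
Proof.
move=> ss tt; rewrite -lee_fin -!cdf2E le_measure ?inE//; try exact: measurable_quadrant.
by move=> z [z1 z2]; split; [exact: le_trans ss|exact: le_trans tt].
Qed.

(** The increment of a joint distribution function is controlled by those of its
    marginals alone: couplings with given marginals have equicontinuous
    distribution functions, with a modulus that tends to [0] on the right. *)
Lemma cdf2_modulus mu nu pi (s s' t t' : R) : couplings mu nu pi -> s <= s' -> t <= t' ->
  cdf2 pi s' t' <=
  cdf2 pi s t + (cdf1 mu s' - cdf1 mu s) + (cdf1 nu t' - cdf1 nu t).
Proof.
move=> cpl ss tt.
have mB (r : R) : measurable_fun setT (fun z : plane => below r z.1).
  exact: measurable_below.
have mB' (r : R) : measurable_fun setT (fun z : plane => below r z.2).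
  exact: measurable_below.
have b0 (r x : R) : 0 <= below r x by rewrite /below.
pose f (u v : R) (z : plane) := below u z.1 * below v z.2.
pose g (u v : R) (z : plane) := below u z.1 + below v z.2.
have mf u v : measurable_fun setT (f u v) by exact: measurable_funM.
have mg u v : measurable_fun setT (g u v) by exact: measurable_funD.
have If u v : (\int[pi]_z (f u v z)%:E = (cdf2 pi u v)%:E)%E.
  have := integral_below_bilinear u v 0 0 0 1 cpl.
  rewrite !mul0r !add0r mul1r => <-.
  by apply: eq_integral => z _; rewrite !mul0r !add0r mul1r.
have Ig u v : (\int[pi]_z (g u v z)%:E = (cdf1 mu u + cdf1 nu v)%:E)%E.
  have := integral_below_bilinear u v 0 1 1 0 cpl.
  rewrite !mul0r !add0r !mul1r addr0 => <-.
  by apply: eq_integral => z _; rewrite !mul0r !add0r !mul1r addr0.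
have : (\int[pi]_z (f s' t' z + 1 * g s t z)%:E <=
        \int[pi]_z (f s t z + 1 * g s' t' z)%:E)%E.
  apply: ge0_le_integral_EFin.
  - by apply: measurable_funD => //; exact: measurable_funM.
  - by apply: measurable_funD => //; exact: measurable_funM.
  - by move=> z; rewrite addr_ge0// ?mul1r ?mulr_ge0// addr_ge0.
  move=> z; rewrite /f /g /below !mul1r.
  have [h1|h1] := leP z.1 s; have [h2|h2] := leP z.2 t;
    rewrite ?(le_trans h1 ss) ?(le_trans h2 tt) /=.
  - lra.
  - by case: (z.2 <= t') => /=; lra.
  - by case: (z.1 <= s') => /=; lra.
  - by case: (z.2 <= t'); case: (z.1 <= s') => /=; lra.
rewrite -!ge0_integralDZ//; first last.
- by move=> z; rewrite addr_ge0.
- by move=> z; rewrite mulr_ge0.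
- by move=> z; rewrite addr_ge0.
- by move=> z; rewrite mulr_ge0.
by rewrite !If !Ig !mul1e -!EFinD lee_fin; lra.
Qed.

Lemma integral_square_ge (f : plane -> R) (s t h c : R) :
  measurable_fun setT f -> (forall p, 0 <= f p) -> 0 <= c -> 0 < h ->
  (forall p, s <= p.1 <= s + h -> t <= p.2 <= t + h -> c <= f p) ->
  ((c * h ^+ 2)%:E <= \int[leb \x leb]_p (f p)%:E)%E.
Proof.
move=> mf f0 c0 h0 fc.
pose S : set plane := `[s, s + h] `*` `[t, t + h].
have mS : measurable S by apply: measurableX; exact: measurable_itv.
have -> : ((c * h ^+ 2)%:E = \int[leb \x leb]_p (c * \1_S p)%:E)%E.
  under eq_integral do rewrite EFinM.
  rewrite ge0_integralZl//; last by apply/measurable_EFinP; exact: measurable_indic.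
  rewrite integral_indic// setIT [X in (_ * X)%E]product_measure1E; try exact: measurable_itv.
  have lebh (u : R) : leb `[u, u + h]%classic = h%:E.
    by rewrite lebesgue_measure_itv/= lte_fin ltrDl h0 -EFinB addrAC subrr add0r.
  by rewrite [X in (_ * (X * _))%E]lebh [X in (_ * (_ * X))%E]lebh -!EFinM expr2.
apply: ge0_le_integral_EFin => //.
- by apply: measurable_funM => //; exact: measurable_indic.
- by move=> p; rewrite mulr_ge0.
- move=> p; rewrite indicE; have [|] := boolP (p \in S); last by rewrite mulr0.
  rewrite inE => -[/=]; rewrite !in_itv/= mulr1 => h1 h2; exact: fc.
Qed.

(** Convergence holds at every point, also where the limit is discontinuous: if the
    distribution functions differ by more than [e] at [(s, t)], by equicontinuity on
    the right they differ by at least [e / 2] on a square with lower left corner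
    [(s, t)], of a size that does not depend on [gamma], and the mean-square
    distance is bounded below. *)
Lemma cdf2_cvg_of_gap mu nu (pi : R -> probR2 R) pi0 :
  (forall gamma : R, 0 < gamma -> couplings mu nu (pi gamma)) -> couplings mu nu pi0 ->
  (forall e : R, 0 < e -> \forall gamma \near (0 : R)^'+,
    (\int[leb \x leb]_p ((cdf2 (pi gamma) p.1 p.2 - cdf2 pi0 p.1 p.2) ^+ 2)%:E <= e%:E)%E) ->
  forall s t, cdf2 (pi gamma) s t @[gamma --> (0 : R)^'+] --> cdf2 pi0 s t.
Proof.
move=> cpl cpl0 gap s t; apply/cvgrPdist_le => e e0.
have e8 : 0 < e / 8 by lra.
have [h1 h10 Fh] := cdf1_right_continuous mu s e8.
have [h2 h20 Gh] := cdf1_right_continuous nu t e8.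
pose h := Num.min h1 h2.
have h0 : 0 < h by rewrite lt_min h10.
have eh0 : 0 < (e / 2) ^+ 2 * h ^+ 2 / 2.
  by rewrite divr_gt0// mulr_gt0// exprn_gt0//; lra.
near=> gamma.
have g0 : 0 < gamma by near: gamma; exact: nbhs_right_gt.
have small : (\int[leb \x leb]_p ((cdf2 (pi gamma) p.1 p.2 - cdf2 pi0 p.1 p.2) ^+ 2)%:E
    <= ((e / 2) ^+ 2 * h ^+ 2 / 2)%:E)%E by near: gamma; exact: gap.
rewrite leNgt; apply/negP => big.
have local pi' u v : couplings mu nu pi' -> s <= u <= s + h -> t <= v <= t + h ->
    cdf2 pi' s t <= cdf2 pi' u v <= cdf2 pi' s t + e / 4.
  move=> cpl' /andP[su us] /andP[tv vt].
  rewrite cdf2_nondecreasing//=; apply: (le_trans (cdf2_modulus cpl' su tv)).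
  have uh : u <= s + h1 by apply: (le_trans us); rewrite lerD2l ge_min lexx.
  have vh : v <= t + h2 by apply: (le_trans vt); rewrite lerD2l ge_min lexx orbT.
  have := cdf1_nondecreasing mu uh; have := cdf1_nondecreasing nu vh; lra.
have : (((e / 2) ^+ 2 * h ^+ 2)%:E <= ((e / 2) ^+ 2 * h ^+ 2 / 2)%:E)%E.
  apply: le_trans small; apply: (@integral_square_ge _ s t) => //.
  - by apply: measurable_funX; apply: measurable_funB; exact: measurable_cdf2.
  - by move=> p; exact: sqr_ge0.
  - exact: sqr_ge0.
  move=> p p1 p2; rewrite -(real_normK (num_real (cdf2 _ _ _ - _))).
  rewrite ler_sqr ?nnegrE//; last lra.
  have := local _ _ _ (cpl _ g0) p1 p2; have := local _ _ _ cpl0 p1 p2.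
  move: big; case: (ger0P (cdf2 pi0 s t - _)) => ?; case: ger0P => ?; lra.
rewrite lee_fin; lra.
Unshelve. all: by end_near. Qed.

End WeakLimit.

(** * Step functions on grids *)

Section WeakConvergence.
Context {R : realType}.
Local Notation line := (measurableTypeR R).
Local Notation plane := (measurableTypeR R * measurableTypeR R)%type.
Implicit Types (mu nu : probR R) (pi : probR2 R).

(** Heine-Cantor, with only one of the two points in the compact square. *)
Lemma continuous_unif_on_square (f : R * R -> R) (N e : R) : continuous f -> 0 < e ->
  exists2 d, 0 < d & forall p q : R * R, - N <= p.1 <= N -> - N <= p.2 <= N ->
    `|p.1 - q.1| < d -> `|p.2 - q.2| < d -> `|f p - f q| <= e.
Proof.
move=> cf e0.
pose K : set (R * R) := `[- N, N] `*` `[- N, N].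
have cK : compact K by apply: compact_setX; exact: segment_compact.
have /compact_near_coveringP/(_ R (0 : R)^'+ (fun d p => forall q : R * R,
    `|p.1 - q.1| < d -> `|p.2 - q.2| < d -> `|f p - f q| <= e)) := cK.
have H x : K x -> \forall x' \near x & d \near (0 : R)^'+,
    forall q : R * R, `|x'.1 - q.1| < d -> `|x'.2 - q.2| < d -> `|f x' - f q| <= e.
  move=> _.
  have e2 : 0 < e / 2 by rewrite divr_gt0.
  have /cvgrPdist_le/(_ _ e2) [[A B] /= [nA nB] AB] := cf x.
  have /nbhs_ballP[a /= a0 aA] := nA; have /nbhs_ballP[b /= b0 bB] := nB.
  pose r := Num.min a b / 2.
  have r0 : 0 < r by rewrite divr_gt0// lt_min a0.
  have ra : r + r <= a by rewrite -splitr ge_min lexx.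
  have rb : r + r <= b by rewrite -splitr ge_min lexx orbT.
  exists (ball x r, [set d | d < r]).
    split; first exact: nbhsx_ballx.
    exact: nbhs_right_lt.
  move=> [y d] [/= [y1 y2] dr] q q1 q2.
  have fy : `|f x - f y| <= e / 2.
    apply: AB; split => /=; [apply: aA|apply: bB].
      by apply: (lt_le_trans y1); apply: le_trans ra; rewrite lerDl ltW.
    by apply: (lt_le_trans y2); apply: le_trans rb; rewrite lerDl ltW.
  have fq : `|f x - f q| <= e / 2.
    apply: AB; split => /=; [apply: aA|apply: bB].
      apply: (lt_le_trans _ ra); rewrite /ball/=.
      rewrite (_ : x.1 - q.1 = (x.1 - y.1) + (y.1 - q.1)); last by ring.
      by apply: (le_lt_trans (ler_normD _ _)); rewrite ltrD// (lt_trans q1).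
    apply: (lt_le_trans _ rb); rewrite /ball/=.
    rewrite (_ : x.2 - q.2 = (x.2 - y.2) + (y.2 - q.2)); last by ring.
    by apply: (le_lt_trans (ler_normD _ _)); rewrite ltrD// (lt_trans q2).
  rewrite (_ : f y - f q = (f x - f q) - (f x - f y)); last by ring.
  by apply: (le_trans (ler_normB _ _)); lra.
move=> /(_ _ H) Kd.
have [d [Kd' d0]] : exists d : R, (K `<=` (fun p => forall q : R * R,
    `|p.1 - q.1| < d -> `|p.2 - q.2| < d -> `|f p - f q| <= e)) /\ 0 < d.
  apply: (@filter_ex _ (0 : R)^'+); near=> d; split; last by near: d; exact: nbhs_right_gt.
  by near: d.
exists d => // p q p1 p2; apply: Kd'.
by split; rewrite /= in_itv.
Unshelve. all: by end_near. Qed.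

Definition window (N x : R) : R := below N x - below (- N) x.

Definition grid (N : R) (n i : nat) : R := - N + i%:R * (2 * N / n%:R).

(** The indicator of a half-open interval of the grid, written so that the integral
    of a product of cells is a combination of values of [cdf2]. *)
Definition cell (N : R) (n i : nat) (x : R) : R :=
  below (grid N n i.+1) x - below (grid N n i) x.

Definition step (f : R * R -> R) (N : R) (n : nat) (z : plane) : R :=
  \sum_(i < n) \sum_(j < n)
    f (grid N n i, grid N n j) * (cell N n i z.1 * cell N n j z.2).

Lemma sum_cell (N x : R) n : (0 < n)%N -> \sum_(i < n) cell N n i x = window N x.
Proof.
move=> n0; rewrite -(big_mkord xpredT (fun i => cell N n i x)) telescope_sumr//.
have n0' : n%:R != 0 :> R by rewrite pnatr_eq0 -lt0n.
rewrite /window /grid mul0r addr0; congr (below _ _ - _).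
by field.
Qed.

Lemma grid_nondecreasing (N : R) n i : 0 <= N -> grid N n i <= grid N n i.+1.
Proof.
by move=> N0; rewrite /grid lerD2l ler_wpM2r ?ler_nat// divr_ge0// mulr_ge0.
Qed.

Lemma cell_ge0 (N x : R) n i : 0 <= N -> 0 <= cell N n i x.
Proof.
move=> N0; rewrite subr_ge0 /below ler_nat.
by have [h|//] := leP x (grid N n i); rewrite (le_trans h)// grid_nondecreasing.
Qed.

Lemma cell_neq0 (N x : R) n i : 0 <= N -> cell N n i x != 0 ->
  grid N n i < x <= grid N n i.+1.
Proof.
move=> N0; rewrite /cell /below.
have [h|h] := leP x (grid N n i).
  by rewrite (le_trans h (grid_nondecreasing _ _ N0)) subrr eqxx.
by have [|] := leP x (grid N n i.+1); rewrite //= subrr eqxx.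
Qed.

Lemma window_itv (N x : R) : 0 <= N -> 0 <= window N x <= 1.
Proof.
move=> N0; rewrite /window /below.
have [h|h] := leP x (- N); first by rewrite (_ : x <= N) ?subrr ?lexx//; lra.
by case: (x <= N); rewrite /= subr0 ?lexx ler01.
Qed.

(** The products of cells are a partition of unity on the half-open square of side
    [2 * N]; on a cell, [f] is close to its value at the lower left corner by
    uniform continuity.  Outside of the square the step function vanishes, and the
    last term takes over. *)
Lemma step_approximation (f : R * R -> R) (B N e : R) : continuous f -> 0 < N -> 0 < e ->
  (forall z, `|f z| <= B) ->
  exists n, forall z : plane, `|f z - step f N n z| <=
    e + B * ((1 - window N z.1) + (1 - window N z.2)).
Proof.
move=> cf N0 e0 fB.
have B0 : 0 <= B by apply: le_trans (fB (0, 0)).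
have [d d0 fd] := continuous_unif_on_square N cf e0.
have [n n0 nd] : exists2 n, (0 < n)%N & 2 * N / n%:R < d.
  exists (Num.truncn (2 * N / d)).+1 => //.
  by rewrite ltr_pdivrMr ?ltr0n// -ltr_pdivrMl// mulrC truncnS_gt.
have N0' := ltW N0.
have n0' : 0 < n%:R :> R by rewrite ltr0n.
exists n => z.
have gridN i : (i < n)%N -> - N <= grid N n i <= N.
  move=> i_n; rewrite /grid lerDl mulr_ge0 ?divr_ge0 ?mulr_ge0//=.
  have : i%:R * (2 * N / n%:R) <= n%:R * (2 * N / n%:R).
    by rewrite ler_wpM2r ?divr_ge0 ?mulr_ge0// ler_nat ltnW.
  rewrite [leRHS]mulrC divfK ?gt_eqF//; lra.
have near_grid i x : cell N n i x != 0 -> `|grid N n i - x| < d.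
  move=> /(cell_neq0 N0') /andP[h1 h2]; rewrite ltr0_norm; last lra.
  have : grid N n i.+1 = grid N n i + 2 * N / n%:R.
    by rewrite /grid -natr1 mulrDl mul1r addrA.
  move: h2 nd; move: (2 * N / n%:R) => u; lra.
set w := window N z.1; set w' := window N z.2.
have /andP[w0 w1] := window_itv z.1 N0'; have /andP[w0' w1'] := window_itv z.2 N0'.
have W : w * w' = \sum_(i < n) \sum_(j < n) (cell N n i z.1 * cell N n j z.2).
  rewrite /w /w' -!(sum_cell _ _ n0) big_distrl/=.
  by apply: eq_bigr => i _; rewrite big_distrr.
have -> : f z - step f N n z = f z * (1 - w * w') +
    \sum_(i < n) \sum_(j < n) ((f z - f (grid N n i, grid N n j)) *
      (cell N n i z.1 * cell N n j z.2)).
  rewrite mulrBr mulr1 -addrA; congr (_ + _).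
  rewrite W /step big_distrr/= -!sumrN -big_split/=; apply: eq_bigr => i _.
  rewrite big_distrr/= -!sumrN -big_split/=; apply: eq_bigr => j _.
  by ring.
apply: (le_trans (ler_normD _ _)); rewrite addrC lerD//.
  apply: (@le_trans _ _ (e * (w * w'))).
    rewrite W big_distrr/=; apply: (le_trans (ler_norm_sum _ _ _)).
    apply: ler_sum => i _; rewrite big_distrr/=; apply: (le_trans (ler_norm_sum _ _ _)).
    apply: ler_sum => j _.
    have c1 := cell_ge0 z.1 n i N0'; have c2 := cell_ge0 z.2 n j N0'.
    rewrite normrM (ger0_norm (mulr_ge0 c1 c2)).
    have [->|n1] := eqVneq (cell N n i z.1) 0; first by rewrite mul0r !mulr0.
    have [->|n2] := eqVneq (cell N n j z.2) 0; first by rewrite !mulr0.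
    apply: ler_wpM2r; first exact: mulr_ge0.
    rewrite distrC; apply: fd => /=.
    - exact: gridN.
    - exact: gridN.
    - exact: near_grid.
    - exact: near_grid.
  by rewrite ler_piMr ?(ltW e0)// mulr_ile1.
rewrite normrM (ger0_norm (_ : 0 <= 1 - w * w')); last by rewrite subr_ge0 mulr_ile1.
apply: ler_pM => //; first by rewrite subr_ge0 mulr_ile1.
have : 0 <= (1 - w) * (1 - w') by rewrite mulr_ge0// subr_ge0.
lra.
Qed.

Lemma measurable_window (N : R) : measurable_fun [set: line] (window N : line -> line).
Proof. by apply: measurable_funB; apply: measurable_below. Qed.

Lemma measurable_step f (N : R) n : measurable_fun setT (step f N n).
Proof.
apply: measurable_sum => i; apply: measurable_sum => j.
apply: measurable_funM => //.
by apply: measurable_funM; apply: measurable_funB; apply: measurable_below.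
Qed.

(** Measurability for the product sigma-algebra: a continuous function is a pointwise
    limit of step functions on growing squares. *)
Lemma continuous_measurable_plane (f : R * R -> R) (B : R) :
  continuous f -> (forall z, `|f z| <= B) -> measurable_fun setT (f : plane -> R).
Proof.
move=> cf fB.
have ex (m : nat) : exists n, forall z : plane, `|f z - step f m.+1%:R n z| <=
    m.+1%:R^-1 + B * ((1 - window m.+1%:R z.1) + (1 - window m.+1%:R z.2)).
  by apply: step_approximation => //; rewrite ?invr_gt0 ltr0n.
have [n nP] := choice ex.
apply: (@measurable_fun_cvg _ _ _ _ (fun m => step f m.+1%:R (n m))).
  by move=> m; exact: measurable_step.
move=> z _; apply/cvgrPdist_le => e e0.
near=> m.
apply: (le_trans (nP m z)).
have win (x : R) : `|x| < m.+1%:R -> window m.+1%:R x = 1.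
  rewrite ltr_norml /window /below => /andP[h1 h2].
  by rewrite (ltW h2) leNgt h1 subr0.
rewrite !win ?subrr ?addr0 ?mulr0 ?addr0.
- near: m; have := @near_infty_natSinv_lt R (PosNum e0); apply: filterS => m /ltW//.
- near: m; apply: filterS (nbhs_infty_ger `|z.2|) => m /= h.
  by rewrite (le_lt_trans h)// ltr_nat.
- near: m; apply: filterS (nbhs_infty_ger `|z.1|) => m /= h.
  by rewrite (le_lt_trans h)// ltr_nat.
Unshelve. all: by end_near. Qed.

End WeakConvergence.

(** * Weak convergence of couplings *)

Section CouplingConvergence.
Context {R : realType}.
Local Notation line := (measurableTypeR R).
Local Notation plane := (measurableTypeR R * measurableTypeR R)%type.
Implicit Types (mu nu : probR R) (pi : probR2 R).

Lemma bounded_integrable pi (g : plane -> R) (M : R) :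
  measurable_fun setT g -> (forall z, `|g z| <= M) ->
  pi.-integrable setT (EFin \o g).
Proof.
move=> mg gM; apply: measurable_bounded_integrable => //.
  by rewrite (le_lt_trans (probability_le1 _ _)) ?ltry.
exists M; split; first exact: num_real.
by move=> r Mr z _ /=; rewrite (le_trans (gM z))// ltW.
Qed.

(** Measurability and boundedness are included so that this class of test functions
    is stable under linear combinations. *)
Definition integral_cvg {I : Type} (F : set_system I) (P : I -> probR2 R) (Q : probR2 R)
    (g : plane -> R) : Prop :=
  [/\ measurable_fun setT g, exists M, forall z, `|g z| <= M &
      \int[P i]_z g z @[i --> F] --> \int[Q]_z g z].

Section Closure.
Context {I : Type} (F : set_system I) {FF : Filter F} (P : I -> probR2 R) (Q : probR2 R).

Lemma integral_cvgZ (c : R) g :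
  integral_cvg F P Q g -> integral_cvg F P Q (fun z => c * g z).
Proof.
move=> [mg [M gM] cg]; split.
- exact: measurable_funM.
- by exists (`|c| * M) => z; rewrite normrM ler_wpM2l.
have E pi : \int[pi]_z (c * g z) = c * \int[pi]_z g z.
  by rewrite RintegralZl//; exact: bounded_integrable gM.
rewrite E; under eq_cvg do rewrite E.
by apply: cvgM cg; exact: cvg_cst.
Qed.

Lemma integral_cvgD g h : integral_cvg F P Q g -> integral_cvg F P Q h ->
  integral_cvg F P Q (fun z => g z + h z).
Proof.
move=> [mg [M gM] cg] [mh [N hN] ch]; split.
- exact: measurable_funD.
- by exists (M + N) => z; rewrite (le_trans (ler_normD _ _))// lerD.
have E pi : \int[pi]_z (g z + h z) = \int[pi]_z g z + \int[pi]_z h z.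
  by rewrite RintegralD//; [exact: bounded_integrable gM|exact: bounded_integrable hN].
rewrite E; under eq_cvg do rewrite E.
exact: cvgD cg ch.
Qed.

Lemma integral_cvg_sum n (g : nat -> plane -> R) :
  (forall i, integral_cvg F P Q (g i)) ->
  integral_cvg F P Q (fun z => \sum_(i < n) g i z).
Proof.
move=> gc; elim: n => [|n IH].
  rewrite (_ : (fun z => _) = (fun z => 0 * g 0%N z)); first exact: integral_cvgZ.
  by apply/funext => z; rewrite big_ord0 mul0r.
rewrite (_ : (fun z => _) = (fun z => \sum_(i < n) g i z + g n z)); first exact: integral_cvgD.
by apply/funext => z; rewrite big_ord_recr.
Qed.

End Closure.

Lemma Rintegral_quadrant pi (s t : R) :
  \int[pi]_z (below s z.1 * below t z.2) = cdf2 pi s t.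
Proof.
rewrite /Rintegral /cdf2; congr fine.
under eq_integral do rewrite below_quadrant.
by rewrite integral_indic ?setIT//; exact: measurable_quadrant.
Qed.

Lemma integral_window mu nu pi (N : R) : couplings mu nu pi ->
  \int[pi]_z ((1 - window N z.1) + (1 - window N z.2)) =
  (1 - (cdf1 mu N - cdf1 mu (- N))) + (1 - (cdf1 nu N - cdf1 nu (- N))).
Proof.
move=> cpl.
have mB (r : R) : measurable_fun setT (fun z : plane => below r z.1) by exact: measurable_below.
have mB' (r : R) : measurable_fun setT (fun z : plane => below r z.2) by exact: measurable_below.
have b1 (r x : R) : `|below r x| <= 1 by rewrite /below; case: (x <= r); rewrite ?normr1 ?normr0.
pose g (c u : R) (z : plane) :=
  c + (-1) * below u z.1 + (-1) * below u z.2 + 0 * (below u z.1 * below u z.2).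
have Ig c u : \int[pi]_z g c u z = c - cdf1 mu u - cdf1 nu u.
  rewrite /Rintegral (integral_below_bilinear u u c (-1) (-1) 0 cpl)/=; ring.
have ig c u : pi.-integrable setT (EFin \o g c u).
  apply: (@bounded_integrable _ _ (`|c| + 1 + 1)).
    apply: measurable_funD; last by apply: measurable_funM => //; exact: measurable_funM.
    by apply: measurable_funD; [apply: measurable_funD|]=> //; exact: measurable_funM.
  move=> z; rewrite /g mul0r addr0 !mulN1r.
  by rewrite (le_trans (ler_normB _ _))// lerD// (le_trans (ler_normB _ _))// lerD.
transitivity (\int[pi]_z (g 2 N z - g 0 (- N) z)).
  by apply: eq_Rintegral => z _; rewrite /g /window; ring.
by rewrite RintegralB// !Ig; ring.
Qed.

(** Fixed marginals make the family tight, and the step approximation of a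
    continuous bounded function is uniformly good on all couplings; integrals of
    step functions are combinations of values of [cdf2]. *)
Lemma weak_cvg_of_cdf2 {I : Type} (F : set_system I) {FF : Filter F} mu nu
    (P : I -> probR2 R) (Q : probR2 R) :
  (\forall i \near F, couplings mu nu (P i)) -> couplings mu nu Q ->
  (forall s t, cdf2 (P i) s t @[i --> F] --> cdf2 Q s t) ->
  weakly_converges F P Q.
Proof.
move=> cplP cplQ PQ f cf [M0 [_ fM0]].
pose B := `|M0| + 1.
have fB z : `|f z| <= B.
  by apply: fM0 => //; rewrite /B (le_lt_trans (ler_norm _))// ltrDl.
have B0 : 0 < B by rewrite /B ltr_wpDl.
have mf : measurable_fun setT (f : plane -> R) by exact: continuous_measurable_plane fB.
apply/cvgrPdist_le => e e0.
(* Two approximation errors of at most [2 * (e / 9)], and [e / 9] for the step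
   function, stay below [e]. *)
have e1 : 0 < e / 9 by rewrite divr_gt0.
have e1B : 0 < e / 9 / (4 * B) by rewrite divr_gt0// mulr_gt0.
have [N1 N10 tail1] := cdf1_tails mu e1B.
have [N2 N20 tail2] := cdf1_tails nu e1B.
pose N := Num.max N1 N2.
have N0 : 0 < N by rewrite lt_max N10.
have [n approx] := step_approximation cf N0 e1 fB.
have Pquad s t : integral_cvg F P Q (fun z => below s z.1 * below t z.2).
  split.
  - by apply: measurable_funM; exact: measurable_below.
  - exists 1 => z; rewrite /below -natrM normr_nat lern1.
    by case: (z.1 <= s); case: (z.2 <= t).
  by rewrite Rintegral_quadrant; under eq_cvg do rewrite Rintegral_quadrant; exact: PQ.
have [mS [MS SM] cS] : integral_cvg F P Q (step f N n).
  apply: (@integral_cvg_sum _ _ _ _ _ n (fun i z => \sum_(j < n) f (grid N n i, grid N n j) *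
     (cell N n i z.1 * cell N n j z.2))) => i.
  apply: (@integral_cvg_sum _ _ _ _ _ n (fun j z => f (grid N n i, grid N n j) *
     (cell N n i z.1 * cell N n j z.2))) => j.
  apply: integral_cvgZ.
  pose q (u v : R) (z : plane) := below u z.1 * below v z.2.
  set a := grid N n i; set a' := grid N n i.+1.
  set b := grid N n j; set b' := grid N n j.+1.
  rewrite (_ : (fun z => _) = (fun z =>
      q a' b' z + (-1) * q a' b z + (-1) * q a b' z + q a b z)).
    have qN u v : integral_cvg F P Q (fun z => (-1) * q u v z).
      exact: (integral_cvgZ (-1) (Pquad u v)).
    have q2 := integral_cvgD (FF := FF) (Pquad a' b') (qN a' b).
    have q3 := integral_cvgD (FF := FF) q2 (qN a b').
    exact: (integral_cvgD q3 (Pquad a b)).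
  by apply/funext => z; rewrite /q /cell; ring.
have close pi : couplings mu nu pi ->
    `|\int[pi]_z f z - \int[pi]_z step f N n z| <= 2 * (e / 9).
  move=> cpl.
  have fi : pi.-integrable setT (EFin \o f) by exact: bounded_integrable fB.
  have Si : pi.-integrable setT (EFin \o step f N n) by exact: bounded_integrable SM.
  have mw : measurable_fun setT (fun z : plane => (1 - window N z.1) + (1 - window N z.2)).
    have w1 := measurableT_comp (measurable_window N)
      (measurable_fst : measurable_fun setT (fst : plane -> line)).
    have w2 := measurableT_comp (measurable_window N)
      (measurable_snd : measurable_fun setT (snd : plane -> line)).
    by apply: measurable_funD; apply: measurable_funB.
  have wi : pi.-integrable setT
      (EFin \o (fun z : plane => (1 - window N z.1) + (1 - window N z.2))).
    apply: (@bounded_integrable _ _ (2)) => // z.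
    have /andP[? ?] := window_itv z.1 (ltW N0); have /andP[? ?] := window_itv z.2 (ltW N0).
    by rewrite ger0_norm; lra.
  have ci : pi.-integrable setT (EFin \o (fun z : plane => e / 9)).
    by apply: (@bounded_integrable _ _ (`|e / 9|)).
  have Bi : pi.-integrable setT
      (EFin \o (fun z : plane => B * ((1 - window N z.1) + (1 - window N z.2)))).
    apply: (@bounded_integrable _ _ (B * 2)); first exact: measurable_funM.
    move=> z; rewrite normrM (gtr0_norm B0) ler_wpM2l ?(ltW B0)//.
    have /andP[? ?] := window_itv z.1 (ltW N0); have /andP[? ?] := window_itv z.2 (ltW N0).
    by rewrite ger0_norm; lra.
  have Di : pi.-integrable setT (EFin \o (fun z => f z - step f N n z)).
    exact: (integrableB measurableT fi Si).
  rewrite -RintegralB//.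
  apply: (@le_trans _ _ (\int[pi]_z `|f z - step f N n z|)).
    exact: le_normr_Rintegral.
  apply: (@le_trans _ _ (\int[pi]_z (e / 9 + B * ((1 - window N z.1) + (1 - window N z.2))))).
    apply: le_Rintegral => //.
    - exact: (integrable_norm Di).
    - exact: (integrableD measurableT ci Bi).
  rewrite RintegralD// Rintegral_cst// RintegralZl// (integral_window _ cpl).
  rewrite [X in fine X]probability_setT mulr1.
  have [|t1 t2] := tail1 N; first by rewrite le_max lexx.
  have [|t3 t4] := tail2 N; first by rewrite le_max lexx orbT.
  have : (1 - (cdf1 mu N - cdf1 mu (- N))) + (1 - (cdf1 nu N - cdf1 nu (- N)))
    <= 4 * (e / 9 / (4 * B)) by lra.
  move=> /(ler_wpM2l (ltW B0)).
  have -> : B * (4 * (e / 9 / (4 * B))) = e / 9 by field; exact: lt0r_neq0.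
  by move=> tail; lra.
have SPQ : \forall i \near F, `|\int[Q]_z step f N n z - \int[P i]_z step f N n z| <= e / 9.
  by move/cvgrPdist_le: cS; exact.
near=> i.
have cplPi : couplings mu nu (P i) by near: i.
have h1 := close _ cplPi; have h2 := close _ cplQ.
have h3 : `|\int[Q]_z step f N n z - \int[P i]_z step f N n z| <= e / 9 by near: i.
move: h1 h2 h3; rewrite !ler_norml; lra.
Unshelve. all: by end_near. Qed.

End CouplingConvergence.

Theorem proposition17 (R : realType) (mu nu : probR R) (delta : R)
    (hmu : finite_abs_moment mu 2)
    (hdelta : 0 < delta)
    (hnu : finite_abs_moment nu (2 + delta))
    (pi : R -> probR2 R)
    (hpi : forall gamma : R, 0 < gamma -> is_maximizer mu nu gamma (pi gamma)) :
  couplings mu nu (diamond_transport mu nu) /\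
  weakly_converges (0 : R)^'+ pi (diamond_transport mu nu).
Proof.
have cpl0 := diamond_transport_coupling mu nu; split=> //.
have cpl gamma : 0 < gamma -> couplings mu nu (pi gamma) by move=> /hpi[].
apply: (weak_cvg_of_cdf2 (mu := mu) (nu := nu)) => //.
  by near=> gamma; apply: cpl; near: gamma; exact: nbhs_right_gt.
apply: (cdf2_cvg_of_gap cpl cpl0) => e e0.
apply: cdf2_gap_cvg => //.
  by apply: (finite_second_moment _ hmu).
by apply: (finite_second_moment _ hnu); rewrite lerDl ltW.
Unshelve. all: by end_near. Qed.
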